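(* Let $k$ be a field of characteristic zero, let $Q=k[x_1,\ldots,x_n]$ with the standard grading, and let $I\subsetneq Q$ be a monomial ideal. If $I$ is lcm-strongly Golod, then $Q/I$ is Golod.
   Context: For a monomial ideal $I$ with minimal monomial generators $f_1,\ldots,f_t$, let $\operatorname{lcm}(I)=\operatorname{lcm}(f_1,\ldots,f_t)$. Let $\partial_{x_i}$ denote the partial derivative with respect to $x_i$. The ideal $I$ is lcm-strongly Golod if $\partial_{x_i}(f)\,\partial_{x_j}(g)\in I$ for all $i\ne j$ and all monomials $f,g\in I$ such that $\partial_{x_i}(f)\,\partial_{x_j}(g)$ divides $\operatorname{lcm}(I)$ (in $Q$). Golod: let $R=Q/I$ with $I$ a proper homogeneous ideal; let $\mathfrak m$ be the homogeneous maximal ideal of $R$, $\operatorname{edim}(R)=\dim_k(\mathfrak m/\mathfrak m^2)$, and $K^R$ the Koszul complex on a minimal generating set of $\mathfrak m$. $R$ is Golod if $$\sum_{i\ge 0}\dim_k\operatorname{Tor}_i^R(k,k)\,t^i=\frac{(1+t)^{\operatorname{edim}(R)}}{1-\sum_{j\ge1}\dim_k H_j(K^R)\,t^{j+1}}.$$ *)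

(* Defs.v *)
(* MathComp, with multinomials for k[x_1, ..., x_n]. *)
From HB Require Import structures.
From mathcomp Require Import all_boot all_order all_algebra.
From mathcomp Require Import generic_quotient ring_quotient.
From mathcomp Require Import mpoly.

Set Implicit Arguments.
Unset Strict Implicit.
Unset Printing Implicit Defensive.

Import GRing.Theory.
Local Open Scope ring_scope.

Section MonomialIdeals.
Variables (k : fieldType) (n : nat).
Implicit Types (I : idealr {mpoly k[n]}) (G : seq 'X_{1..n}).

Definition generated_by G (p : {mpoly k[n]}) : Prop :=
  exists c : 'X_{1..n} -> {mpoly k[n]}, p = \sum_(g <- G) c g * 'X_[g].

Definition generates G I : Prop := forall p, p \in I <-> generated_by G p.

(* A finite list of monomials loses no generality, as k[x_1, ..., x_n] is
   Noetherian. *)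
Definition monomial_ideal I : Prop := exists G, generates G I.

(* G is determined by I up to permutation (a repeated monomial would be
   redundant). *)
Definition minimal_monomial_generators G I : Prop :=
  generates G I /\ (forall g, g \in G -> ~ generated_by (rem g G) 'X_[g]).

Definition lcm_monomials G : 'X_{1..n} := \big[@mlcm n/0%MM]_(g <- G) g.

Definition lcm_strongly_golod I : Prop :=
  exists2 G, minimal_monomial_generators G I &
  forall (i j : 'I_n) (f g : 'X_{1..n}),
    i != j -> 'X_[f] \in I -> 'X_[g] \in I ->
    (exists q : {mpoly k[n]},
        'X_[lcm_monomials G] = q * (('X_[f])^`M(i) * ('X_[g])^`M(j))) ->
    ('X_[f])^`M(i) * ('X_[g])^`M(j) \in I.

End MonomialIdeals.

Section SubquotientDimension.
Variables (k : fieldType) (R : comNzRingType) (iota : k -> R) (M : lmodType R).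

(* dim_k (Z / B) = d, where k acts on M through iota : k -> R: some d elements
   of Z form a basis modulo B. *)
Definition has_dim (Z B : M -> Prop) (d : nat) : Prop :=
  exists u : 'I_d -> M,
    [/\ forall i, Z (u i),
        forall a : 'I_d -> k,
          B (\sum_i iota (a i) *: u i) -> forall i, a i = 0
      & forall z, Z z ->
          exists a : 'I_d -> k, B (z - \sum_i iota (a i) *: u i)].

End SubquotientDimension.

Section Golod.
Variables (k : fieldType) (n : nat) (I : idealr {mpoly k[n]}).

Local Notation R := {ideal_quot I}.

Definition proj (p : {mpoly k[n]}) : R := (\pi_R p)%qT.

Definition scalar (a : k) : R := proj a%:MP.

Definition span e (x : 'I_e -> R) (r : R) : Prop :=
  exists c : 'I_e -> R, r = \sum_i c i * x i.

(* The homogeneous maximal ideal of R; it is proper when I is homogeneous. *)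
Definition max_ideal : R -> Prop := span (fun i : 'I_n => proj 'X_i).

Definition max_ideal_sq (r : R) : Prop :=
  exists2 s : seq (R * R),
    (forall p, p \in s -> max_ideal p.1 /\ max_ideal p.2) &
    r = \sum_(p <- s) p.1 * p.2.

Definition is_edim (e : nat) : Prop :=
  @has_dim k R scalar R^o max_ideal max_ideal_sq e.

Definition minimal_generators e (x : 'I_e -> R) : Prop :=
  [/\ forall i, exists d, exists2 p, p \is d.-homog & x i = proj p,
      forall r, max_ideal r <-> span x r
    & forall j, ~ (exists c : 'I_e -> R, x j = \sum_(i | i != j) c i * x i)].

(* The Koszul complex on x_0, ..., x_(e-1), all degrees together: w S is the
   coefficient of the basis vector e_S, which has degree #|S|.  The differential
   is e_S |-> \sum_(i in S) (-1)^#{l in S | l < i} x_i e_(S \ i). *)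
Definition koszul e := {ffun {set 'I_e} -> R^o}.

Definition koszul_diff e (x : 'I_e -> R) (w : koszul e) : koszul e :=
  [ffun T : {set 'I_e} => \sum_(i | i \notin T)
     (-1) ^+ #|[set l in T | (l < i)%N]| * x i * w (i |: T)].

Definition koszul_deg e (j : nat) (w : koszul e) : Prop :=
  forall S : {set 'I_e}, #|S| != j -> w S = 0.

Definition koszul_cycle e (x : 'I_e -> R) j (w : koszul e) : Prop :=
  koszul_deg j w /\ koszul_diff x w = 0.

Definition koszul_bound e (x : 'I_e -> R) j (w : koszul e) : Prop :=
  exists2 u, koszul_deg j.+1 u & w = koszul_diff x u.

(* h j = dim_k H_j(K^R) for all j; this does not depend on the minimal
   generating set x. *)
Definition koszul_dims (h : nat -> nat) : Prop :=
  exists (e : nat) (x : 'I_e -> R), minimal_generators x /\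
    forall j, has_dim scalar (koszul_cycle x j) (koszul_bound x j) (h j).

(* A resolution ... -> R^(b 1) -> R^(b 0) -> R/m = k -> 0 by free modules of row
   vectors, with d i : R^(b i.+1) -> R^(b i).  The R-linear augmentation
   R^(b 0) -> R/m is v |-> class of v *m eps. *)
Definition resolution (b : nat -> nat)
    (d : forall i, 'M[R]_(b i.+1, b i)) (eps : 'cV[R]_(b 0)) : Prop :=
  [/\ exists v : 'rV_(b 0), max_ideal (1 - (v *m eps) 0 0),
      forall v : 'rV_(b 0),
        max_ideal ((v *m eps) 0 0) <-> exists u, v = u *m d 0
    & forall i (v : 'rV_(b i.+1)),
        v *m d i = 0 <-> exists u, v = u *m d i.+1].

Definition in_mF m (v : 'rV[R]_m) : Prop := forall j, max_ideal (v 0 j).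

(* The cycles and boundaries of F (x)_R k = F/mF, lifted to F. *)
Definition tor_cycle (b : nat -> nat) (d : forall i, 'M[R]_(b i.+1, b i)) i :
    'rV[R]_(b i) -> Prop :=
  match i return 'rV[R]_(b i) -> Prop with
  | 0 => fun=> True
  | i'.+1 => fun v => in_mF (v *m d i')
  end.

Definition tor_bound (b : nat -> nat) (d : forall i, 'M[R]_(b i.+1, b i)) i
    (v : 'rV[R]_(b i)) : Prop :=
  exists u, in_mF (v - u *m d i).

(* P i = dim_k Tor_i^R(k, k) for all i; this does not depend on the resolution,
   and finite free resolutions exist because R is Noetherian. *)
Definition tor_dims (P : nat -> nat) : Prop :=
  exists (b : nat -> nat) (d : forall i, 'M[R]_(b i.+1, b i))
         (eps : 'cV[R]_(b 0)),
    resolution d eps /\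
    forall i, has_dim scalar (@tor_cycle b d i) (@tor_bound b d i) (P i).

(* Coefficients of 1 - \sum_(j >= 1) h_j t^(j+1). *)
Definition golod_denom (h : nat -> nat) (m : nat) : int :=
  match m with
  | 0 => 1
  | 1 => 0
  | j.+1 => - (h j)%:Z
  end.

(* The quotient of power series is cleared of its denominator, which is
   invertible in Z[[t]].  Meant for homogeneous I. *)
Definition golod : Prop :=
  exists (e : nat) (P h : nat -> nat),
    [/\ is_edim e, tor_dims P, koszul_dims h
      & forall N : nat,
          \sum_(i < N.+1) (P i)%:Z * golod_denom h (N - i) = ('C(e, N))%:Z].

End Golod.

(* Main.v *)
From HB Require Import structures.
From Stdlib Require Import Classical.
From mathcomp Require Import all_boot all_order all_algebra.
From mathcomp Require Import ring zify.
From mathcomp Require Import generic_quotient ring_quotient.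
From mathcomp Require Import mpoly.
Require Import Defs.
Set Implicit Arguments.
Unset Strict Implicit.
Unset Printing Implicit Defensive.
Import GRing.Theory.
Local Open Scope ring_scope.

(** Let R = k[x_1, ..., x_n] / I, let K be the Koszul complex of R on the variables
    outside I and let l be the lcm of the generators.  In a multidegree a, choose
    an index i with a_i > l_i if there is one, and any i with a_i > 0 otherwise.
    Left multiplication by e_i / x_i is then a homotopy contracting the part of K
    in multidegree a onto the span of the elements c e_S, with c a monomial, such
    that i is in S and c x_i is in I; if a does not divide l, there is no such
    element.  Hence the homology of K has representatives of this shape in
    multidegrees dividing l (the predicate [near]).

    In the product of (f / x_i) e_S and (g / x_j) e_T, with f and g in I, either
    i = j and e_S e_T = 0, or the coefficient is a scalar multiple of a product
    of derivatives in different directions, which is in I if the multidegree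
    divides l.  So products of representatives lie in the ideal [far] of K spanned
    by the multidegrees that do not divide l, and the same homotopy contracts this
    ideal.  Solving the defining equations of Massey products inside [far] gives a
    trivial Massey operation gam, on words v in a basis of the homology of K in
    positive degrees.  By Golod's theorem, the elements a (x) w, with a in K and w
    a word, then form a minimal free resolution of k with the differential

      a (x) w  |->  da (x) w + sum of the +- a gam(v) (x) u over w = v u, v <> 1,

    whose ranks satisfy the recursion required. *)

(** * Exterior algebras and Koszul complexes *)

Section Exterior.
Variables (R : comNzRingType) (e : nat).
Implicit Types (S T U V : {set 'I_e}) (i j : 'I_e).

(* The sign of the shuffle e_S e_T = +- e_(S u T); defined for arbitrary S and T
   so that it is multiplicative in each argument. *)
Definition sg S T : R := \prod_(s in S) \prod_(t in T) (-1) ^+ (t < s)%N.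

Lemma sg0l T : sg set0 T = 1.
Proof. by rewrite /sg big_set0. Qed.

Lemma sg0r S : sg S set0 = 1.
Proof. by rewrite /sg big1 // => s _; rewrite big_set0. Qed.

Lemma sgUl S S' T : [disjoint S & S'] -> sg (S :|: S') T = sg S T * sg S' T.
Proof.
by move=> dS; rewrite /sg -bigU //; apply: eq_bigl => s; rewrite !inE.
Qed.

Lemma sgUr S T T' : [disjoint T & T'] -> sg S (T :|: T') = sg S T * sg S T'.
Proof.
move=> dT; rewrite /sg -big_split; apply: eq_bigr => s _ /=.
by rewrite -bigU //; apply: eq_bigl => t; rewrite !inE.
Qed.

Lemma sg_sqr S T : sg S T * sg S T = 1.
Proof.
rewrite /sg -big_split big1 //= => s _; rewrite -big_split big1 //= => t _.
by rewrite -expr2 sqrr_sign.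
Qed.

Lemma sg1 i T : sg [set i] T = (-1) ^+ #|[set l in T | (l < i)%N]|.
Proof.
rewrite /sg big_set1 prodrXr; congr (_ ^+ _).
rewrite -sum1_card big_mkcond [RHS]big_mkcond; apply: eq_bigr => l _.
by rewrite inE; case: (l \in T) => //=; case: (l < i)%N.
Qed.

Lemma sg_expr S T : exists d, sg S T = (-1) ^+ d.
Proof.
exists (\sum_(s in S) \sum_(t in T) (t < s))%N; rewrite /sg -prodrXr.
by apply: eq_bigr => s _; rewrite prodrXr.
Qed.

Lemma sg11 i j : i != j -> sg [set i] [set j] = - sg [set j] [set i].
Proof.
rewrite /sg !big_set1 neq_ltn => /orP[] ij; rewrite ij ltnNge ltnW //=.
by rewrite opprK.
Qed.

(** For each s in S exactly one of i < s and s < i holds, so the two shuffles together contribute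
    one sign per element of S. *)
Lemma sg1C i S : i \notin S -> sg [set i] S * sg S [set i] = (-1) ^+ #|S|.
Proof.
move=> iS; rewrite /sg big_set1 -big_split /= -prodr_const; apply: eq_bigr => s sS.
rewrite big_set1 -exprD.
have : s != i by apply: contraNneq iS => <-.
by rewrite neq_ltn => /orP[] si; rewrite si ltnNge ltnW //= expr1.
Qed.

Local Notation ext := {ffun {set 'I_e} -> R^o}.
Implicit Types (a b c w : ext).

Definition ebas S : ext := [ffun T => (T == S)%:R].

Lemma ext_expand w : w = \sum_S w S *: ebas S.
Proof.
apply/ffunP => T; rewrite sum_ffunE (bigD1 T) //= big1 => [|S ST].
  by rewrite !ffunE eqxx /= addr0 /GRing.scale /= mulr1.
by rewrite !ffunE eq_sym (negPf ST) scaler0.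
Qed.

Lemma ext_ind (P : ext -> Prop) :
  (forall S, P (ebas S)) -> P 0 -> (forall r a b, P a -> P b -> P (r *: a + b)) ->
  forall w, P w.
Proof.
move=> PE P0 PD w; rewrite (ext_expand w).
by elim/big_rec: _ => // S a _ Pa; apply: PD.
Qed.

Definition ebmul S T : ext :=
  if [disjoint S & T] then sg S T *: ebas (S :|: T) else 0.

Fact emul_key : unit. Proof. by []. Qed.
Definition emul a b : ext :=
  locked_with emul_key (\sum_S \sum_T (a S * b T) *: ebmul S T).

Lemma emulDl a a' b : emul (a + a') b = emul a b + emul a' b.
Proof.
rewrite /emul !locked_withE -big_split; apply: eq_bigr => S _; rewrite -big_split.
by apply: eq_bigr => T _; rewrite ffunE mulrDl scalerDl.
Qed.

Lemma emulDr a b b' : emul a (b + b') = emul a b + emul a b'.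
Proof.
rewrite /emul !locked_withE -big_split; apply: eq_bigr => S _; rewrite -big_split.
by apply: eq_bigr => T _; rewrite ffunE mulrDr scalerDl.
Qed.

Lemma emulZl r a b : emul (r *: a) b = r *: emul a b.
Proof.
rewrite /emul !locked_withE scaler_sumr; apply: eq_bigr => S _; rewrite scaler_sumr.
by apply: eq_bigr => T _; rewrite ffunE scalerA mulrA.
Qed.

Lemma emulZr r a b : emul a (r *: b) = r *: emul a b.
Proof.
rewrite /emul !locked_withE scaler_sumr; apply: eq_bigr => S _; rewrite scaler_sumr.
by apply: eq_bigr => T _; rewrite ffunE scalerA mulrCA.
Qed.

Lemma emul0l b : emul 0 b = 0.
Proof. by have := emulZl 0 0 b; rewrite !scale0r. Qed.

Lemma emul0r a : emul a 0 = 0.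
Proof. by have := emulZr 0 a 0; rewrite !scale0r. Qed.

Lemma emulNl a b : emul (- a) b = - emul a b.
Proof. by rewrite -scaleN1r emulZl scaleN1r. Qed.

Lemma emulNr a b : emul a (- b) = - emul a b.
Proof. by rewrite -scaleN1r emulZr scaleN1r. Qed.

Lemma emul_suml (X : Type) (r : seq X) (P : pred X) (F : X -> ext) b :
  emul (\sum_(i <- r | P i) F i) b = \sum_(i <- r | P i) emul (F i) b.
Proof. by elim/big_rec2: _ => [|i y1 y2 _ <-]; rewrite ?emul0l ?emulDl. Qed.

Lemma emul_sumr (X : Type) (r : seq X) (P : pred X) (F : X -> ext) a :
  emul a (\sum_(i <- r | P i) F i) = \sum_(i <- r | P i) emul a (F i).
Proof. by elim/big_rec2: _ => [|i y1 y2 _ <-]; rewrite ?emul0r ?emulDr. Qed.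

Lemma emul_ebas S T : emul (ebas S) (ebas T) = ebmul S T.
Proof.
rewrite /emul locked_withE (bigD1 S) //= [X in _ + X]big1 => [|S' S'S]; last first.
  by rewrite big1 // => T' _; rewrite !ffunE (negPf S'S) mul0r scale0r.
rewrite addr0 (bigD1 T) //= big1 => [|T' T'T]; last first.
  by rewrite !ffunE (negPf T'T) mulr0 scale0r.
by rewrite !ffunE !eqxx mulr1 scale1r addr0.
Qed.

Lemma emulA a b c : emul a (emul b c) = emul (emul a b) c.
Proof.
elim/ext_ind: a => [S|| r a a' IH IH']; first last.
- by rewrite !emulDl !emulZl IH IH'.
- by rewrite !emul0l.
elim/ext_ind: b => [T|| r b b' IH IH']; first last.
- by rewrite !(emulDl, emulDr) !(emulZl, emulZr) IH IH'.
- by rewrite !(emul0l, emul0r).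
elim/ext_ind: c => [V|| r c c' IH IH']; first last.
- by rewrite !(emulDl, emulDr) !(emulZl, emulZr) IH IH'.
- by rewrite !(emul0l, emul0r).
rewrite !emul_ebas /ebmul.
have dUr : [disjoint S & T :|: V] = [disjoint S & T] && [disjoint S & V].
  by rewrite -!setI_eq0 setIUr setU_eq0.
have dUl : [disjoint S :|: T & V] = [disjoint S & V] && [disjoint T & V].
  by rewrite -!setI_eq0 setIUl setU_eq0.
case: (boolP [disjoint T & V]) => TV; case: (boolP [disjoint S & T]) => ST;
  rewrite ?emul0l ?emul0r // ?emulZl ?emulZr ?emul_ebas /ebmul ?dUl ?dUr
    ?ST ?TV ?(negPf ST) ?(negPf TV) ?andbF /= ?scaler0 //.
rewrite andbT; case: ifP => SV; last by rewrite !scaler0.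
by rewrite !scalerA setUA sgUl // sgUr //; congr (_ *: _); ring.
Qed.

(** The parity automorphism; it carries the Koszul signs in the Leibniz rules. *)
Definition bar w : ext := [ffun S : {set 'I_e} => (-1) ^+ #|S| * w S].

Lemma barD a b : bar (a + b) = bar a + bar b.
Proof. by apply/ffunP => S; rewrite !ffunE mulrDr. Qed.

Lemma barZ r a : bar (r *: a) = r *: bar a.
Proof. by apply/ffunP => S; rewrite !ffunE /GRing.scale /= mulrCA. Qed.

Lemma bar0 : bar 0 = 0.
Proof. by apply/ffunP => S; rewrite !ffunE mulr0. Qed.

Lemma barN a : bar (- a) = - bar a.
Proof. by rewrite -scaleN1r barZ scaleN1r. Qed.

Lemma bar_sum (X : Type) (r : seq X) (P : pred X) (F : X -> ext) :
  bar (\sum_(i <- r | P i) F i) = \sum_(i <- r | P i) bar (F i).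
Proof. by elim/big_rec2: _ => [|i y1 y2 _ <-]; rewrite ?bar0 ?barD. Qed.

Lemma barK a : bar (bar a) = a.
Proof. by apply/ffunP => S; rewrite !ffunE signrMK. Qed.

Lemma bar_ebas S : bar (ebas S) = (-1) ^+ #|S| *: ebas S.
Proof.
apply/ffunP => T; rewrite !ffunE /GRing.scale /=.
by case: eqP => [->|]; rewrite ?mulr0.
Qed.

Lemma bar_emul a b : bar (emul a b) = emul (bar a) (bar b).
Proof.
elim/ext_ind: a => [S|| r a a' IH IH']; first last.
- by rewrite !(emulDl, barD, emulZl, barZ) IH IH'.
- by rewrite !(emul0l, bar0, emul0l).
elim/ext_ind: b => [T|| r b b' IH IH']; first last.
- by rewrite !(emulDr, barD, emulZr, barZ) IH IH'.
- by rewrite !(emul0r, bar0, emul0r).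
rewrite !bar_ebas emulZl emulZr !emul_ebas /ebmul.
case: ifP => ST; last by rewrite bar0 !scaler0.
rewrite barZ bar_ebas !scalerA; congr (_ *: _).
move: ST; rewrite -setI_eq0 => /eqP ST.
by rewrite cardsU ST cards0 subn0 exprD mulrC.
Qed.

(** Contraction with the dual vector of e_i, the antiderivation that sends e_i to 1 and the other
    e_j to 0. *)
Definition contr i w : ext :=
  [ffun T : {set 'I_e} => if i \in T then 0 else sg [set i] T * w (i |: T)].

Lemma contrD i a b : contr i (a + b) = contr i a + contr i b.
Proof.
by apply/ffunP => S; rewrite !ffunE; case: ifP; rewrite ?addr0 // mulrDr.
Qed.

Lemma contrZ i r a : contr i (r *: a) = r *: contr i a.
Proof.
by apply/ffunP => S; rewrite !ffunE /GRing.scale /=; case: ifP; rewrite ?mulr0 // mulrCA.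
Qed.

Lemma contr0 i : contr i 0 = 0.
Proof. by apply/ffunP => S; rewrite !ffunE mulr0; case: ifP. Qed.

Lemma contr_ebas i S :
  contr i (ebas S) = if i \in S then sg [set i] (S :\ i) *: ebas (S :\ i) else 0.
Proof.
apply/ffunP => T; rewrite !ffunE; case: ifP => iT.
  case: ifP => iS; rewrite !ffunE ?eqxx //.
  case: eqP => [TS|]; last by rewrite scaler0.
  by move: iT; rewrite TS setD11.
case: ifP => iS; rewrite ffunE.
  case: eqP => [<-|TS]; rewrite ?ffunE.
    by rewrite setU1K ?iT // eqxx.
  case: eqP => [TS'|]; last by rewrite scaler0 mulr0.
  by case: TS; rewrite TS' setD1K.
by case: eqP => [TS|]; rewrite ?mulr0 //; move: iS; rewrite -TS setU11.
Qed.

Lemma disjU1 i T : i \notin T -> [disjoint [set i] & T].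
Proof. by rewrite disjoints1. Qed.

(* When i lies in both S and T the left side vanishes and the two terms on the
   right cancel. *)
Lemma contr_emul i a b :
  contr i (emul a b) = emul (contr i a) b + emul (bar a) (contr i b).
Proof.
elim/ext_ind: a => [S|| r a a' IH IH']; first last.
- rewrite !(emulDl, contrD, barD) !(emulZl, contrZ, barZ) IH IH'.
  by rewrite scalerDr addrACA.
- by rewrite !(emul0l, contr0, bar0) addr0.
elim/ext_ind: b => [T|| r b b' IH IH']; first last.
- rewrite !(emulDr, contrD) !(emulZr, contrZ) IH IH'.
  by rewrite scalerDr addrACA.
- by rewrite !(emul0r, contr0) addr0.
rewrite emul_ebas bar_ebas emulZl !contr_ebas.
have iD X : i \notin X :\ i by rewrite setD11.
case: (boolP (i \in S)) => iS; case: (boolP (i \in T)) => iT.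
- have -> : ebmul S T = 0.
    rewrite /ebmul ifF //; apply/negP => /disjoint_setI0 /setP/(_ i).
    by rewrite !inE iS iT.
  rewrite contr0 emulZl emulZr !emul_ebas /ebmul.
  have dST (X Y : {set 'I_e}) : [disjoint X :\ i & Y] = [disjoint X :\ i & Y :\ i].
    rewrite -!setI_eq0; congr (_ == _); apply/setP => l; rewrite !inE.
    by case: (l == i).
  have eU : S :\ i :|: T = S :|: T :\ i.
    by apply/setP => l; rewrite !inE; case: eqP => //= ->; rewrite iS iT.
  have dST' : [disjoint S & T :\ i] = [disjoint S :\ i & T :\ i].
    by rewrite disjoint_sym dST disjoint_sym.
  rewrite dST dST' eU.
  case: ifP => d; last by rewrite !scaler0 addr0.
  rewrite !scalerA -scalerDl; set E := ebas _.
  have -> : sg S (T :\ i) = sg [set i] (T :\ i) * sg (S :\ i) (T :\ i).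
    by rewrite -{1}(setD1K iS) sgUl ?disjU1.
  have -> : sg (S :\ i) T = sg (S :\ i) [set i] * sg (S :\ i) (T :\ i).
    by rewrite -{1}(setD1K iT) sgUr ?disjU1.
  have p2 := sg_sqr [set i] (T :\ i); have q := sg1C (iD S).
  rewrite (cardsD1 i S) iS add1n exprS -q mulrA.
  set p := sg _ _ in p2 *; set t := sg (S :\ i) (T :\ i).
  set u := sg _ _; set v := sg (S :\ i) _.
  by rewrite (_ : _ + _ = u * v * t * (1 - p * p)); [rewrite p2 subrr mulr0 scale0r | ring].
- rewrite emul0r scaler0 addr0 emulZl emul_ebas /ebmul.
  have -> : [disjoint S :\ i & T] = [disjoint S & T].
    rewrite -!setI_eq0; congr (_ == _); apply/setP => l; rewrite !inE.
    by case: eqP => // ->; rewrite (negPf iT) !andbF.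
  case: ifP => ST; last by rewrite contr0 scaler0.
  rewrite contrZ contr_ebas inE iS /= !scalerA.
  have eU : (S :|: T) :\ i = S :\ i :|: T.
    by apply/setP => l; rewrite !inE; case: eqP => // ->; rewrite (negPf iT).
  rewrite eU sgUr; last first.
    by apply: disjointWl ST; rewrite subD1set.
  rewrite -{1}(setD1K iS) sgUl ?disjU1 //; congr (_ *: _).
  have p2 := sg_sqr [set i] T; set p := sg _ T in p2 *.
  by rewrite -[RHS]mulr1 -p2; ring.
- rewrite emul0l add0r emulZr emul_ebas /ebmul.
  have -> : [disjoint S & T :\ i] = [disjoint S & T].
    rewrite -!setI_eq0; congr (_ == _); apply/setP => l; rewrite !inE.
    by case: eqP => // ->; rewrite (negPf iS).
  case: ifP => ST; last by rewrite contr0 !scaler0.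
  rewrite contrZ contr_ebas inE iT orbT /= !scalerA.
  have eU : (S :|: T) :\ i = S :|: T :\ i.
    by apply/setP => l; rewrite !inE; case: eqP => // ->; rewrite (negPf iS).
  rewrite eU sgUr; last first.
    by rewrite disjoint_sym; apply: disjointWl (subD1set _ _) _; rewrite disjoint_sym.
  rewrite -{1}(setD1K iT) sgUr ?disjU1 //; congr (_ *: _).
  by rewrite -(sg1C iS); ring.
rewrite emul0l emul0r scaler0 addr0 /ebmul.
case: ifP => ST; last by rewrite contr0.
by rewrite contrZ contr_ebas inE (negPf iS) (negPf iT) scaler0.
Qed.

(** * The Koszul differential *)

Variable x : 'I_e -> R.

(** Stated over any commutative ring, but convertible to [koszul_diff] over the quotient ring; the
    final proofs use this conversion. *)
Definition edelta w : ext := [ffun T : {set 'I_e} => \sum_(i | i \notin T)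
   (-1) ^+ #|[set l in T | (l < i)%N]| * x i * w (i |: T)].

(** As a combination of contractions, the differential inherits the Leibniz rule from [contr_emul],
    and it squares to zero because contractions anticommute. *)
Lemma edeltaE w : edelta w = \sum_i x i *: contr i w.
Proof.
apply/ffunP => T; rewrite ffunE sum_ffunE big_mkcond; apply: eq_bigr => i _.
rewrite !ffunE; case: (i \in T) => /=; first by rewrite scaler0.
by rewrite sg1 /GRing.scale /= mulrCA mulrA.
Qed.

Lemma edeltaD a b : edelta (a + b) = edelta a + edelta b.
Proof.
rewrite !edeltaE -big_split; apply: eq_bigr => i _.
by rewrite contrD scalerDr.
Qed.

Lemma edeltaZ r a : edelta (r *: a) = r *: edelta a.
Proof.
rewrite !edeltaE scaler_sumr; apply: eq_bigr => i _.
by rewrite contrZ !scalerA mulrC.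
Qed.

Lemma edelta0 : edelta 0 = 0.
Proof. by have := edeltaZ 0 0; rewrite !scale0r. Qed.

Lemma edeltaN a : edelta (- a) = - edelta a.
Proof. by rewrite -scaleN1r edeltaZ scaleN1r. Qed.

Lemma edelta_sum (X : Type) (r : seq X) (P : pred X) (F : X -> ext) :
  edelta (\sum_(i <- r | P i) F i) = \sum_(i <- r | P i) edelta (F i).
Proof. by elim/big_rec2: _ => [|i y1 y2 _ <-]; rewrite ?edelta0 ?edeltaD. Qed.

Lemma edelta_emul a b :
  edelta (emul a b) = emul (edelta a) b + emul (bar a) (edelta b).
Proof.
rewrite !edeltaE emul_suml emul_sumr -big_split; apply: eq_bigr => i _.
by rewrite contr_emul scalerDr emulZl emulZr.
Qed.

Lemma contrC i j w : contr i (contr j w) = - contr j (contr i w).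
Proof.
have [->|ij] := eqVneq i j.
  apply/ffunP => T; rewrite !ffunE; case: ifP; rewrite ?oppr0 // => _.
  by rewrite setU11 mulr0 oppr0.
apply/ffunP => T; rewrite !ffunE !inE [j == i]eq_sym (negPf ij) /=.
case: (boolP (i \in T)) => iT; case: (boolP (j \in T)) => jT;
  rewrite ?mulr0 ?oppr0 //.
rewrite setUCA sgUr ?disjoints1 ?inE // sgUr ?disjoints1 ?inE // (sg11 ij).
by ring.
Qed.

Lemma edeltaK w : edelta (edelta w) = 0.
Proof.
rewrite !edeltaE.
have E i : contr i (\sum_j x j *: contr j w) = \sum_j x j *: contr i (contr j w).
  by elim/big_rec2: _ => [|j y1 y2 _ <-]; rewrite ?contr0 // contrD contrZ.
under eq_bigr => i _ do rewrite E scaler_sumr.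
pose A i j := x i *: (x j *: contr i (contr j w)).
have AC i j : A i j = - A j i.
  by rewrite /A contrC !scalerN !scalerA mulrC.
have A0 i : A i i = 0.
  rewrite /A (_ : contr i _ = 0) ?scaler0 //.
  by apply/ffunP => T; rewrite !ffunE setU11 mulr0; case: ifP.
(* pairing (i, j) with (j, i) rather than dividing by 2 *)
rewrite (eq_bigr (fun i : 'I_e => \sum_(j < e | (j < i)%N) A i j + \sum_(j < e | (i < j)%N) A i j));
  last first.
  move=> i _; rewrite (bigD1 i) //= -/(A i i) A0 add0r.
  rewrite (bigID (fun j : 'I_e => (j < i)%N)) /=; congr (_ + _);
    by apply: eq_bigl => j; rewrite -val_eqE /=; case: ltngtP.
rewrite big_split /= (exchange_big_dep predT) //= -big_split big1 //= => i _.
by rewrite -big_split big1 //= => j _; rewrite AC addNr.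
Qed.

Lemma edelta_bar a : edelta (bar a) = - bar (edelta a).
Proof.
apply/ffunP => T; rewrite !ffunE mulr_sumr -sumrN; apply: eq_bigr => i iT.
by rewrite ffunE cardsU1 iT exprS; ring.
Qed.

(** * Homological degree in the exterior algebra *)

Definition edeg (d : nat) w : Prop := forall S, #|S| != d -> w S = 0.

Lemma edeg0 d : edeg d 0.
Proof. by move=> S _; rewrite ffunE. Qed.

Lemma edegD d a b : edeg d a -> edeg d b -> edeg d (a + b).
Proof. by move=> ha hb S jS; rewrite ffunE ha // hb // addr0. Qed.

Lemma edegZ d r a : edeg d a -> edeg d (r *: a).
Proof. by move=> ha S jS; rewrite ffunE ha // scaler0. Qed.

Lemma edegN d a : edeg d a -> edeg d (- a).
Proof. by rewrite -scaleN1r; apply: edegZ. Qed.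

Lemma edeg_sum d (X : Type) (r : seq X) (P : pred X) (F : X -> ext) :
  (forall y, P y -> edeg d (F y)) -> edeg d (\sum_(i <- r | P i) F i).
Proof. by move=> h; elim/big_ind: _; [apply: edeg0 | apply: edegD|]. Qed.

Lemma edeg_ebas S : edeg #|S| (ebas S).
Proof. by move=> T ST; rewrite ffunE; case: (T =P S) => // TS; rewrite TS eqxx in ST. Qed.

Lemma edeg_bar d a : edeg d a -> edeg d (bar a).
Proof. by move=> ha S jS; rewrite ffunE ha // mulr0. Qed.

Lemma bar_edeg d a : edeg d a -> bar a = (-1) ^+ d *: a.
Proof.
move=> ha; apply/ffunP => S; rewrite !ffunE /GRing.scale /=.
by have [<-//|/ha->] := eqVneq #|S| d; rewrite !mulr0.
Qed.

Lemma edeg_emul d d' a b : edeg d a -> edeg d' b -> edeg (d + d') (emul a b).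
Proof.
move=> ha hb; rewrite /emul locked_withE; apply: edeg_sum => S _; apply: edeg_sum => T _.
have [iS|/ha->] := eqVneq #|S| d; last by rewrite mul0r scale0r; apply: edeg0.
have [jT|/hb->] := eqVneq #|T| d'; last by rewrite mulr0 scale0r; apply: edeg0.
apply: edegZ; rewrite /ebmul; case: ifP => [ST|_]; last exact: edeg0.
apply: edegZ; rewrite -iS -jT -(_ : #|S :|: T| = #|S| + #|T|)%N; first exact: edeg_ebas.
by rewrite cardsU (disjoint_setI0 ST) cards0 subn0.
Qed.

Lemma edeg_edelta d a : edeg d.+1 a -> edeg d (edelta a).
Proof.
move=> ha S jS; rewrite ffunE big1 // => i iS.
by rewrite ha ?mulr0 // cardsU1 iS add1n eqSS.
Qed.

Lemma edelta_edeg0 a : edeg 0 a -> edelta a = 0.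
Proof.
move=> ha; apply/ffunP => S; rewrite !ffunE big1 // => i iS.
by rewrite ha ?mulr0 // cardsU1 iS.
Qed.

Lemma emul1 b : emul (ebas set0) b = b.
Proof.
elim/ext_ind: b => [S||r a b IH IH']; first last.
- by rewrite emulDr emulZr IH IH'.
- by rewrite emul0r.
by rewrite emul_ebas /ebmul -setI_eq0 set0I eqxx sg0l scale1r set0U.
Qed.

Lemma edeg0P a : edeg 0 a -> a = a set0 *: ebas set0.
Proof.
move=> ha; apply/ffunP => S; rewrite !ffunE.
have [->|S0] := eqVneq S set0; first by rewrite /GRing.scale /= mulr1.
by rewrite scaler0 ha // cards_eq0.
Qed.

Lemma edelta_ebas1 i : edelta (ebas [set i]) = x i *: ebas set0.
Proof.
rewrite edeltaE (bigD1 i) //= contr_ebas inE eqxx setDv sg0r scale1r.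
rewrite big1 ?addr0 // => j ji; rewrite contr_ebas inE (negPf ji).
by rewrite scaler0.
Qed.

End Exterior.

(** * The Golod complex of a trivial Massey operation *)

Section Resolution.
Variables (R : comNzRingType) (e : nat) (x : 'I_e -> R).
Variables (B : finType) (deg : B -> nat).
Local Notation ext := {ffun {set 'I_e} -> R^o}.
Local Notation delta := (edelta x).
Variable gam : seq B -> ext.
Implicit Types (f g : seq B -> ext) (u v w : seq B) (h : B) (L n d : nat).

(** The homological degree of a word: as in the bar construction, a homology class of degree d is a
    letter of degree d + 1. *)
Definition wt w : nat := sumn [seq (deg b).+1 | b <- w].

Lemma wt_rcons w h : wt (rcons w h) = (wt w + (deg h).+1)%N.
Proof. by rewrite /wt map_rcons sumn_rcons. Qed.

Lemma wt_cat w u : wt (w ++ u) = (wt w + wt u)%N.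
Proof. by rewrite /wt map_cat sumn_cat. Qed.

Lemma size_le_wt w : (size w <= wt w)%N.
Proof. by elim: w => //= b w IH; rewrite /wt /=; move: IH; rewrite /wt; lia. Qed.

(* A family f : seq B -> ext stands for the sum of the f w (x) w, and
   [phi L v f] for the sum of the bar (f w) * gam (w ++ v) over the words w of
   length at most L. *)
Fixpoint phi L v f : ext :=
  emul (bar (f [::])) (gam v) +
  (if L is L'.+1 then \sum_h phi L' (h :: v) (fun w => f (rcons w h)) else 0).

(** The coefficient at u of the image of f under the Golod differential. The nonempty word split off
    in front of u is written [rcons w h], and L truncates the sum over w. *)
Definition rdiff L f u : ext :=
  delta (f u) + \sum_h phi L [:: h] (fun w => f (rcons w h ++ u)).

Lemma phi_ext L v f g : f =1 g -> phi L v f = phi L v g.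
Proof.
elim: L v f g => [|L IH] v f g fg /=; rewrite fg //.
by congr (_ + _); apply: eq_bigr => h _; apply: IH => w; rewrite fg.
Qed.

Lemma rdiff_ext L f g : f =1 g -> rdiff L f =1 rdiff L g.
Proof.
move=> fg u; rewrite /rdiff fg; congr (_ + _); apply: eq_bigr => h _.
by apply: phi_ext => w; rewrite fg.
Qed.

Lemma phi_lin L v r f g :
  phi L v (fun w => r *: f w + g w) = r *: phi L v f + phi L v g.
Proof.
elim: L v f g => [|L IH] v f g /=; rewrite barD barZ emulDl emulZl.
  by rewrite !addr0.
rewrite scalerDr addrACA; congr (_ + _); rewrite scaler_sumr -big_split.
by apply: eq_bigr => h _; rewrite IH.
Qed.

Lemma phi0 L v f : (forall w, f w = 0) -> phi L v f = 0.
Proof.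
elim: L v f => [|L IH] v f f0 /=; rewrite f0 bar0 emul0l add0r // big1 // => h _.
by apply: IH => w; rewrite f0.
Qed.

Lemma rdiff_lin L r f g u :
  rdiff L (fun w => r *: f w + g w) u = r *: rdiff L f u + rdiff L g u.
Proof.
rewrite /rdiff edeltaD edeltaZ scalerDr addrACA; congr (_ + _).
by rewrite scaler_sumr -big_split; apply: eq_bigr => h _; rewrite phi_lin.
Qed.

Lemma rdiff0 L f u : (forall w, f w = 0) -> rdiff L f u = 0.
Proof.
by move=> f0; rewrite /rdiff f0 edelta0 add0r big1 // => h _; apply: phi0.
Qed.

(** The differential cuts words at the front, so it commutes with stripping a last letter. This
    drives the induction in [rdiff_exact]. *)
Lemma rdiff_rcons L f u h :
  rdiff L f (rcons u h) = rdiff L (fun w => f (rcons w h)) u.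
Proof.
rewrite /rdiff; congr (_ + _); apply: eq_bigr => h' _; apply: phi_ext => w.
by rewrite rcons_cat.
Qed.

Definition bounded L f := forall w, (L < size w)%N -> f w = 0.

Lemma bounded_rcons L f h : bounded L.+1 f -> bounded L (fun w => f (rcons w h)).
Proof. by move=> bf w Lw; rewrite bf // size_rcons. Qed.

Lemma phi_stable L L' v f : bounded L f -> (L <= L')%N -> phi L' v f = phi L v f.
Proof.
elim: L L' v f => [|L IH] [|L'] v f bf //= LL'; congr (_ + _); last first.
  by apply: eq_bigr => h _; apply: IH => //; apply: bounded_rcons.
by rewrite big1 // => h _; apply: phi0 => w; rewrite bf // size_rcons.
Qed.

Lemma rdiff_stable L L' f : bounded L f -> (L <= L')%N -> rdiff L' f =1 rdiff L f.
Proof.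
move=> bf LL' u; rewrite /rdiff; congr (_ + _); apply: eq_bigr => h _.
apply: phi_stable => // w Lw; apply: bf.
by rewrite size_cat size_rcons; lia.
Qed.

Hypothesis gam_delta : forall v, v != [::] ->
  delta (gam v) =
  - \sum_(1 <= i < size v) emul (bar (gam (take i v))) (gam (drop i v)).

(** The Leibniz rule and the Massey equation for [gam (w ++ v)] give one term for every cut of
    [w ++ v]. Cuts inside w, or between w and v, are absorbed by [rdiff]; cuts inside v remain. *)
Lemma phi_delta L L' v f : bounded L f -> (L <= L')%N -> v != [::] ->
  delta (phi L v f) + phi L v (rdiff L' f) =
  - \sum_(1 <= i < size v) emul (bar (phi L (take i v) f)) (gam (drop i v)).
Proof.
have main a w : w != [::] -> delta (emul (bar a) (gam w)) + emul (bar (delta a)) (gam w)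
    = - \sum_(1 <= i < size w) emul (bar (emul (bar a) (gam (take i w)))) (gam (drop i w)).
  move=> w0; rewrite edelta_emul edelta_bar emulNl barK gam_delta //.
  rewrite addrAC addNr add0r emulNr emul_sumr; congr (- _).
  by apply: eq_bigr => i _; rewrite bar_emul barK emulA.
elim: L L' v f => [|L IH] L' v f bf LL' v0 /=.
  rewrite !addr0 /rdiff big1 ?addr0 => [|h _]; last first.
    by apply: phi0 => w; rewrite bf // size_cat size_rcons addSn.
  by rewrite main //; under [in RHS]eq_bigr do rewrite addr0.
rewrite edeltaD [delta (\sum_(h : B) _)]edelta_sum /rdiff barD emulDl bar_sum emul_suml.
have -> : \sum_h phi L (h :: v) (fun w => delta (f (rcons w h)) +
      \sum_h' phi L' [:: h'] (fun w' => f (rcons w' h' ++ rcons w h))) =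
   \sum_h phi L (h :: v) (rdiff L' (fun w => f (rcons w h))).
  by apply: eq_bigr => h _; apply: phi_ext => w; rewrite -rdiff_rcons.
have -> : \sum_h emul (bar (phi L' [:: h] (fun w => f (rcons w h ++ [::])))) (gam v) =
    \sum_h emul (bar (phi L' [:: h] (fun w => f (rcons w h)))) (gam v).
  apply: eq_bigr => h _; congr (emul (bar _) _); apply: phi_ext => w.
  by rewrite cats0.
(* The cut of [h :: v] after its first letter is set apart: it cancels the term that [rdiff]
   contributes at the empty word. *)
have step h : delta (phi L (h :: v) (fun w => f (rcons w h))) +
    phi L (h :: v) (rdiff L' (fun w => f (rcons w h))) =
    - (emul (bar (phi L' [:: h] (fun w => f (rcons w h)))) (gam v) +
    \sum_(1 <= i < size v)
      emul (bar (phi L (h :: take i v) (fun w => f (rcons w h)))) (gam (drop i v))).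
  rewrite IH //; [|exact: bounded_rcons|lia].
  rewrite /= big_ltn ?ltnS ?lt0n ?size_eq0 // /= take0 drop0 big_add1 /=.
  by rewrite (phi_stable [:: h] (bounded_rcons h bf)) // ltnW.
rewrite -[X in _ + X]addrA addrACA [X in _ + (_ + X)]addrC [X in _ + X]addrA.
rewrite -big_split (eq_bigr _ (fun h _ => step h)) sumrN big_split opprD /=.
rewrite [X in _ + X]addrAC addNr add0r.
rewrite main // -opprD; congr (- _); rewrite [X in _ + X]exchange_big -big_split /=.
by apply: eq_bigr => i _; rewrite barD emulDl bar_sum emul_suml.
Qed.

Lemma bounded_cat L f u h : bounded L f -> bounded L (fun w => f (rcons w h ++ u)).
Proof. by move=> bf w Lw; rewrite bf // size_cat size_rcons; lia. Qed.

(** For each last letter h of the word split off, [phi_delta] is applied to the one-letter word h,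
    which has no proper cut, so its right side is zero. *)
Lemma rdiffK L f u : bounded L f -> rdiff L (rdiff L f) u = 0.
Proof.
move=> bf; rewrite {1}/rdiff {1}/rdiff edeltaD edeltaK add0r edelta_sum -big_split.
apply: big1 => h _ /=.
rewrite [X in _ + X](_ : _ = phi L [:: h] (rdiff L (fun w => f (rcons w h ++ u)))).
  by rewrite phi_delta ?big_geq ?oppr0 //; apply: bounded_cat.
apply: phi_ext => w; rewrite /rdiff; congr (_ + _); apply: eq_bigr => h' _.
by apply: phi_ext => w'; rewrite -!cats1 -!catA.
Qed.

(* Total degree: #|S| for the exterior factor plus deg b + 1 for each letter. *)
Definition Fdeg n f := forall w (S : {set 'I_e}), (#|S| + wt w)%N != n -> f w S = 0.

Lemma Fdeg_edeg n d f w : Fdeg n f -> (d + wt w = n)%N -> edeg d (f w).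
Proof. by move=> hf dn S Sd; apply: hf; move: Sd; apply: contraNneq; lia. Qed.

Lemma Fdeg_lt n f w : Fdeg n f -> (n < wt w)%N -> f w = 0.
Proof.
by move=> hf nw; apply/ffunP => S; rewrite hf ?ffunE //; apply/eqP; lia.
Qed.

Lemma FdegP n f : (forall w d, (d + wt w = n)%N -> edeg d (f w)) ->
  (forall w, (n < wt w)%N -> f w = 0) -> Fdeg n f.
Proof.
move=> h1 h2 w S Sw; have [nw|wn] := ltnP n (wt w); first by rewrite h2 // ffunE.
by apply: (h1 w (n - wt w)%N); [rewrite subnK | move: Sw; apply: contraNneq; lia].
Qed.

Lemma Fdeg_bounded n L f : Fdeg n f -> (n <= L)%N -> bounded L f.
Proof.
move=> hf nL w Lw; apply: Fdeg_lt hf _.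
by apply: leq_ltn_trans nL _; apply: leq_trans Lw (size_le_wt w).
Qed.

Lemma Fdeg_rcons n m f h : Fdeg n f -> (m + (deg h).+1 = n)%N ->
  Fdeg m (fun w => f (rcons w h)).
Proof.
move=> hf mn w S Sw; apply: hf; rewrite wt_rcons -mn addnA eqn_add2r; exact: Sw.
Qed.

Hypothesis gam_deg : forall v d, wt v = d.+1 -> edeg d (gam v).

Lemma phi_deg n L v d f : Fdeg n f -> (n + wt v = d.+1)%N -> (0 < wt v)%N ->
  edeg d (phi L v f).
Proof.
elim: L n v f => [|L IH] n v f hf nd v0 /=;
  apply: edegD; rewrite -?[in X in X -> _]addr0; try exact: edeg0.
- have -> : d = (n + (wt v).-1)%N by lia.
  apply: edeg_emul; first by apply/edeg_bar/(Fdeg_edeg hf); rewrite addn0.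
  by apply: gam_deg; lia.
- have -> : d = (n + (wt v).-1)%N by lia.
  apply: edeg_emul; first by apply/edeg_bar/(Fdeg_edeg hf); rewrite addn0.
  by apply: gam_deg; lia.
apply: edeg_sum => h _; have [hn|nh] := leqP (deg h).+1 n.
  apply: (IH (n - (deg h).+1)%N); [|by rewrite /wt /=; move: nd; rewrite /wt; lia|by []].
  by apply: Fdeg_rcons hf _; rewrite subnK.
rewrite phi0 => [|w]; first exact: edeg0.
by apply: Fdeg_lt hf _; rewrite wt_rcons; lia.
Qed.

Lemma rdiff_deg n L f : Fdeg n.+1 f -> Fdeg n (rdiff L f).
Proof.
move=> hf; apply: FdegP => [u d dn|u nu].
  apply: edegD; first by apply/edeg_edelta/(Fdeg_edeg hf); lia.
  apply: edeg_sum => h _; have [hd|dh] := leqP (deg h).+1 d.+1.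
    apply: (@phi_deg (d - deg h)%N); rewrite ?/wt //=; last by lia.
    move=> w S Sw; apply: hf; rewrite wt_cat wt_rcons; apply: contraNneq Sw.
    by rewrite -/(wt w); lia.
  rewrite phi0 => [|w]; first exact: edeg0.
  by apply: Fdeg_lt hf _; rewrite wt_cat wt_rcons; lia.
rewrite /rdiff big1 => [|h _]; last first.
  by apply: phi0 => w; apply: Fdeg_lt hf _; rewrite wt_cat wt_rcons; lia.
rewrite addr0; have [un|un] := eqVneq (wt u) n.+1.
  by apply/edelta_edeg0/(Fdeg_edeg hf).
by rewrite (Fdeg_lt hf) ?edelta0 //; lia.
Qed.

(** * Exactness and minimality of the Golod complex *)

Variables (k : fieldType) (iota : {rmorphism k -> R}) (M : R -> Prop).
Hypothesis M_span : forall r, M r <-> exists c : 'I_e -> R, r = \sum_i c i * x i.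
Hypothesis M_residue : forall r, exists c, M (r - iota c).
Hypothesis deg_gt0 : forall b, (0 < deg b)%N.
Hypothesis gam_free : forall d (a : B -> k) (y : ext), (0 < d)%N -> edeg d.+1 y ->
  \sum_(b | deg b == d) iota (a b) *: gam [:: b] = delta y ->
  forall b, deg b = d -> a b = 0.
Hypothesis gam_span : forall d (z : ext), (0 < d)%N -> edeg d z -> delta z = 0 ->
  exists (a : B -> k) (y : ext), edeg d.+1 y /\
    z = \sum_(b | deg b == d) iota (a b) *: gam [:: b] + delta y.

Lemma gam1_cycle b : delta (gam [:: b]) = 0.
Proof. by rewrite gam_delta // big_geq ?oppr0. Qed.

(* The maximal ideal kills the homology: x_i z = delta (e_i z). *)
Lemma M_bound r d (z : ext) : M r -> edeg d z -> delta z = 0 ->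
  exists2 y, edeg d.+1 y & r *: z = delta y.
Proof.
move=> /M_span[c ->] dz z0; exists (\sum_i c i *: emul (ebas R [set i]) z).
  apply: edeg_sum => i _; apply: edegZ; rewrite -add1n; apply: edeg_emul => //.
  by rewrite -(cards1 i); apply: edeg_ebas.
rewrite edelta_sum scaler_suml; apply: eq_bigr => i _.
by rewrite edeltaZ edelta_emul z0 emul0r addr0 edelta_ebas1 emulZl emul1 scalerA.
Qed.

(** A family of degree 0 is a scalar at the empty word; if that scalar is the sum of the c_i x_i,
    then the sum of the c_i e_i is a preimage. *)
Lemma rdiff_exact0 L f : Fdeg 0 f -> M (f [::] set0) ->
  exists2 g, Fdeg 1 g & rdiff L g =1 f.
Proof.
move=> hf /M_span[c cE].
pose y : ext := \sum_i c i *: ebas R [set i].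
have dy : edeg 1 y.
  by apply: edeg_sum => i _; apply: edegZ; rewrite -(cards1 i); apply: edeg_ebas.
exists (fun w => if w is [::] then y else 0).
  apply: FdegP => [[|b w] d|[|b w]] //=; first by rewrite addn0 => ->.
  by move=> _; apply: edeg0.
move=> u; rewrite /rdiff big1 ?addr0 => [|h _]; last first.
  by apply: phi0 => w; case: w.
case: u => [|b u]; last first.
  by rewrite edelta0 (Fdeg_lt hf) //= /wt /=.
rewrite (edeg0P (Fdeg_edeg hf (erefl : (0 + wt [::])%N = 0%N))) cE edelta_sum scaler_suml.
by apply: eq_bigr => i _; rewrite edeltaZ edelta_ebas1 scalerA.
Qed.

Lemma gam1_deg b : edeg (deg b) (gam [:: b]).
Proof. by apply: gam_deg; rewrite /wt /= addn0. Qed.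

Lemma phi_deg0 L h f : Fdeg 0 f -> phi L [:: h] f = f [::] set0 *: gam [:: h].
Proof.
move=> hf; have f0 := Fdeg_edeg hf (erefl : (0 + wt [::])%N = 0%N).
have -> : phi L [:: h] f = emul (bar (f [::])) (gam [:: h]).
  case: L => [|L] /=; rewrite ?addr0 // big1 ?addr0 // => h' _; apply: phi0 => w.
  by apply: Fdeg_lt hf _; rewrite wt_rcons addnS.
by rewrite (bar_edeg f0) expr0 scale1r {1}(edeg0P f0) emulZl emul1.
Qed.

Definition one w : ext := if w == [::] then ebas R set0 else 0.

Lemma Fdeg_one : Fdeg 0 one.
Proof.
apply: FdegP => [w d|[|b w]] //; rewrite /one; case: eqP => [->|_]; last first.
  by move=> _; apply: edeg0.
by rewrite addn0 => ->; rewrite -[X in edeg X](cards0 'I_e); apply: edeg_ebas.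
Qed.

Lemma rdiff_deg0 L f u : Fdeg 0 f -> rdiff L f u = 0.
Proof.
move=> hf; rewrite /rdiff big1 ?addr0 => [|h _].
  by apply: edelta_edeg0; case: u => [|b u]; [apply: (Fdeg_edeg hf)|
    rewrite (Fdeg_lt hf) //; exact: edeg0].
by apply: phi0 => w; apply: (Fdeg_lt hf); rewrite wt_cat wt_rcons; lia.
Qed.

(** Strong induction on the degree. Stripping a last letter from f gives cycles of lower degree,
    which are lifted first. The remaining error is a Koszul cycle at the empty word, removed by a
    boundary and by one-letter words. *)
Lemma rdiff_exact n L f : Fdeg n.+1 f -> (n.+2 <= L)%N -> (forall u, rdiff L f u = 0) ->
  exists2 g, Fdeg n.+2 g & rdiff L g =1 f.
Proof.
elim/ltn_ind: n f => n IH f hf nL f0.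
pose N := n.+1; pose last h w := f (rcons w h).
have last0 h u : rdiff L (last h) u = 0 by rewrite -rdiff_rcons.
(* A preimage of [last h], which has degree N - deg h - 1; for deg h >= N that family is zero, and
   so is its preimage. *)
pose lift h g := [/\ (deg h < N)%N -> Fdeg (N - deg h) g,
  (N <= deg h)%N -> forall w, g w = 0 & rdiff L g =1 last h].
have lift_out h : (N <= deg h)%N -> lift h (fun=> 0).
  move=> Nh; split=> // [|u]; first by rewrite ltnNge Nh.
  rewrite rdiff0 // /last (Fdeg_lt hf) // wt_rcons; rewrite /N in Nh; lia.
have [g gP] : exists g : B -> seq B -> ext, forall h, (deg h).+1 != N -> lift h (g h).
  apply: (@fin_all_exists _ (fun=> seq B -> ext) (fun h g => (deg h).+1 != N -> lift h g)) => h.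
  have [hN|Nh] := leqP N (deg h); first by exists (fun=> 0) => _; apply: lift_out.
  have [hN|hN] := eqVneq (deg h).+1 N; first by exists (fun=> 0).
  have [||||g hg gE] := IH (n - deg h).-1 _ (last h) => //.
  - by have := deg_gt0 h; rewrite /N in Nh hN; lia.
  - by apply: Fdeg_rcons hf _; rewrite /N in Nh hN; lia.
  - by rewrite /N in Nh hN; lia.
  exists g => _; split=> //; rewrite /N in Nh hN *; last by lia.
  by move=> _; rewrite (_ : (n.+1 - deg h = (n - deg h).-1.+2)%N) //; lia.
have phi_g h (gh : seq B -> ext) : lift h gh -> edeg N (phi L [:: h] gh) /\
    delta (phi L [:: h] gh) = - phi L [:: h] (last h).
  case=> g1 g2 g3; split.
    have [hN'|Nh] := leqP N (deg h); first by rewrite phi0; [exact: edeg0|exact: g2].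
    by apply: phi_deg (g1 Nh) _ _; rewrite /wt /=; lia.
  apply/eqP; rewrite -addr_eq0; apply/eqP.
  rewrite -(phi_ext _ _ g3) phi_delta // ?big_geq ?oppr0 //.
  have [hN'|Nh] := leqP N (deg h); first by move=> w _; apply: g2.
  by apply: Fdeg_bounded (g1 Nh) _; rewrite /N in Nh *; lia.
have D0 : delta (f [::]) = - \sum_h phi L [:: h] (last h).
  apply/eqP; rewrite -addr_eq0; apply/eqP; rewrite -[RHS](f0 [::]); congr (_ + _).
  by apply: eq_bigr => h _; apply: phi_ext => w; rewrite cats0.
have df : edeg N (f [::]) by apply: (Fdeg_edeg hf); rewrite addn0.
(* Here [last h] is a scalar r_h. The equation at the empty word makes the sum of the r_h gam(h) a
   boundary; since M kills homology, the residues of the r_h form a linear relation between basis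
   classes and vanish. *)
have fM h : (deg h).+1 = N -> M (f [:: h] set0).
  move=> hN; have n0 : (0 < n)%N by have := deg_gt0 h; rewrite /N in hN; lia.
  have [c cP] := @fin_all_exists _ (fun=> k) _ (fun h => M_residue (f [:: h] set0)).
  have /(@fin_all_exists _ (fun=> ext))[y yP] h' : exists y, edeg (deg h').+1 y /\
      (f [:: h'] set0 - iota (c h')) *: gam [:: h'] = delta y.
    by have [y y1 y2] := M_bound (cP h') (@gam1_deg h') (gam1_cycle h'); exists y.
  suff E : \sum_(b | deg b == n) iota (c b) *: gam [:: b] =
      delta (- f [::] + \sum_(b | deg b != n) phi L [:: b] (g b) -
         \sum_(b | deg b == n) y b).
    have := cP h; rewrite (gam_free n0 _ E) ?rmorph0 ?subr0 //; last by case: hN.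
    apply: edegD; first (apply: edegD; first exact: edegN).
      by apply: edeg_sum => b bn; have [] := phi_g b _ (gP b bn).
    by apply/edegN/edeg_sum => b /eqP <-; have [] := yP b.
  rewrite !edeltaD !edeltaN !edelta_sum D0 opprK.
  rewrite [X in _ = X + _ - _](bigID (fun b => deg b == n)) /= -[X in _ = X - _]addrA.
  rewrite -[X in _ + X - _]big_split [X in _ + X - _]big1 ?addr0 => [|b bn]; last first.
    by have [_ /= ->] := phi_g b _ (gP b bn); rewrite addrN.
  rewrite -sumrB; apply: eq_bigr => b /eqP bn; have [_ <-] := yP b.
  have lastb : Fdeg 0 (last b) by apply: Fdeg_rcons hf _; rewrite bn.
  rewrite (phi_deg0 L b lastb) /last /= scalerBl.
  set p := _ *: _; set q := _ *: _.
  by rewrite opprB addrC subrK.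
have {g gP} [g gP] : exists g : B -> seq B -> ext, forall h, lift h (g h).
  apply: (@fin_all_exists _ (fun=> seq B -> ext) lift) => h.
  have [hN|hN] := eqVneq (deg h).+1 N; last by exists (g h); apply: gP.
  have [||gh g1 g2] := @rdiff_exact0 L (last h).
  - by apply: Fdeg_rcons hf _; rewrite hN.
  - exact: fM.
  exists gh; split=> //; rewrite -hN ?ltnn // => _.
  by rewrite subSnn.
have dz : edeg N (f [::] - \sum_h phi L [:: h] (g h)).
  by apply/edegD => //; apply/edegN/edeg_sum => h _; have [] := phi_g h _ (gP h).
have [|a [y [dy E]]] := gam_span (ltn0Sn n) dz.
  rewrite edeltaD edeltaN edelta_sum D0 -opprD -big_split big1 ?oppr0 //= => h _.
  by have [_ ->] := phi_g h _ (gP h); rewrite addrN.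
(* The differential of 1 (x) h is gam(h), so the basis classes left over at the empty word are hit
   by adding multiples of 1 (x) h with deg h = N. *)
pose c h := if deg h == N then iota (a h) else 0.
pose G w := if w is b :: w' then
  c (seq.last b w') *: one (belast b w') + g (seq.last b w') (belast b w') else y.
have Gr h w : G (rcons w h) = c h *: one w + g h w.
  by case: w => [|b w] //=; rewrite last_rcons belast_rcons.
exists G.
  move=> w S; case/lastP: w => [|w h]; first by rewrite addn0; apply: dy.
  rewrite wt_rcons Gr !ffunE => Sw.
  have -> : g h w S = 0.
    have [g1 g2 _] := gP h; have [hN|Nh] := leqP N (deg h); first by rewrite g2 // ffunE.
    by apply: g1 => //; move: Sw; apply: contraNneq; rewrite /N in Nh *; lia.
  rewrite addr0 /c; case: eqP => [hN|_]; last by rewrite scale0r.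
  rewrite Fdeg_one ?scaler0 //; move: Sw; apply: contraNneq; rewrite hN /N; lia.
move=> u; case/lastP: u => [|u h]; last first.
  rewrite rdiff_rcons (rdiff_ext _ (Gr h)) rdiff_lin rdiff_deg0; last exact: Fdeg_one.
  by rewrite scaler0 add0r; have [_ _ ->] := gP h.
have Ef : f [::] = (\sum_(b | deg b == N) iota (a b) *: gam [:: b] + delta y) +
    \sum_h phi L [:: h] (g h) by rewrite -E subrK.
rewrite /rdiff Ef /= [_ + delta y]addrC -addrA; congr (_ + _).
rewrite [X in X + _]big_mkcond -big_split; apply: eq_bigr => h _ /=.
rewrite (_ : phi _ _ _ = c h *: phi L [:: h] one + phi L [:: h] (g h)).
  congr (_ + _); rewrite phi_deg0; last exact: Fdeg_one.
  by rewrite /one ffunE eqxx scale1r /c; case: eqP; rewrite ?scale0r.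
by rewrite -phi_lin; apply: phi_ext => w; rewrite cats0 Gr.
Qed.

Lemma M_add r r' : M r -> M r' -> M (r + r').
Proof.
move=> /M_span[c ->] /M_span[c' ->]; apply/M_span.
exists (fun i => c i + c' i); rewrite -big_split.
by apply: eq_bigr => i _; rewrite mulrDl.
Qed.

Lemma M_sum (X : Type) (r : seq X) (P : pred X) (F : X -> R) :
  (forall i, P i -> M (F i)) -> M (\sum_(i <- r | P i) F i).
Proof.
move=> FM; elim/big_ind: _ => //; last exact: M_add.
by apply/M_span; exists (fun=> 0); rewrite big1 // => i _; rewrite mul0r.
Qed.

Lemma M_mul a r : M r -> M (a * r).
Proof.
case/M_span=> c ->; apply/M_span; exists (fun i => a * c i).
by rewrite mulr_sumr; apply: eq_bigr => i _; rewrite mulrA.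
Qed.

Lemma M_gen i : M (x i).
Proof.
apply/M_span; exists (fun j => (j == i)%:R); rewrite (bigD1 i) //= eqxx mul1r.
by rewrite big1 ?addr0 // => j /negPf->; rewrite mul0r.
Qed.

Lemma M_emul (a b : ext) S : (forall T, M (b T)) -> M (emul a b S).
Proof.
move=> bM; rewrite /emul locked_withE sum_ffunE; apply: M_sum => T _.
rewrite sum_ffunE; apply: M_sum => U _; rewrite ffunE /GRing.scale /=.
by rewrite mulrAC; apply: M_mul.
Qed.

Hypothesis gam_M : forall v S, v != [::] -> M (gam v S).

(** Minimality: [delta] has coefficients +- x_i, and every other term has a factor [gam v] with v
    nonempty. *)
Lemma rdiff_M L f u S : M (rdiff L f u S).
Proof.
have phiM v f' T : v != [::] -> M (phi L v f' T).
  elim: L v f' T => [|L' IH] v f' T v0 /=; rewrite ffunE.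
    by rewrite ffunE addr0; apply: M_emul => U; apply: gam_M.
  apply: M_add; first by apply: M_emul => U; apply: gam_M.
  by rewrite sum_ffunE; apply: M_sum => h _; apply: IH.
rewrite /rdiff ffunE; apply: M_add.
  rewrite ffunE; apply: M_sum => i _; rewrite mulrAC; apply: M_mul; exact: M_gen.
by rewrite sum_ffunE; apply: M_sum => h _; apply: phiM.
Qed.

End Resolution.

(** * Matrices and Betti numbers *)

Lemma mulmx_lin1 (R : comNzRingType) (m n : nat) (f : 'rV[R]_m -> 'rV[R]_n) :
  linear f -> forall u, u *m lin1_mx f = f u.
Proof.
move=> lf u; pose F : {linear 'rV[R]_m -> 'rV[R]_n} :=
  HB.pack f (GRing.isLinear.Build R _ _ _ f lf).
exact: (mul_rV_lin1 F).
Qed.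

Section Basis.
Variables (e : nat) (B : finType) (deg : B -> nat).
Local Notation wt := (wt deg).

(** The basis vectors e_S (x) w of the Golod complex in degree n. L bounds the word length; [n <= L]
    suffices, as every letter has weight at least 1. *)
Fixpoint basis (L n : nat) : seq ({set 'I_e} * seq B) :=
  [seq (T, [::]) | T <- enum [pred T : {set 'I_e} | #|T| == n]] ++
  (if L is L'.+1 then
     [seq (p.1, rcons p.2 b) | b <- enum [pred b | (deg b < n)%N],
                               p <- basis L' (n - (deg b).+1)%N]
   else [::]).

Lemma mem_basis L n p : (n <= L)%N -> (p \in basis L n) = ((#|p.1| + wt p.2)%N == n).
Proof.
elim: L n p => [|L IH] n [S w] nL.
  case/lastP: w => [|w b]; rewrite /= cats0 ?wt_rcons.
    rewrite addn0; apply/mapP/eqP => [[T]|Sn]; first by rewrite mem_enum inE => /eqP<- [->].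
    by exists S; rewrite // mem_enum inE Sn.
  apply/mapP/eqP => [[T _ [_]]|]; last by lia.
  by move/(congr1 size); rewrite size_rcons.
rewrite /= mem_cat; case/lastP: w => [|w b].
  rewrite addn0 orbC; case: allpairsPdep => [[b [p [_ _ [_]]]]|_] /=.
    by move/(congr1 size); rewrite size_rcons.
  apply/mapP/eqP => [[T]|Sn]; first by rewrite mem_enum inE => /eqP<- [->].
  by exists S; rewrite // mem_enum inE Sn.
rewrite wt_rcons; case: mapP => [[T _ [_]]|_] /=.
  by move/(congr1 size); rewrite size_rcons.
apply/allpairsPdep/eqP => [[b' [p [bn pb [-> /rcons_inj[-> ->]]]]]|Sn].
  have {}bn : (deg b' < n)%N by move: bn; rewrite mem_enum.
  by move: pb; rewrite IH; [move/eqP=> pn; rewrite addnA pn subnK | lia].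
exists b; exists (S, w); split=> //; first by rewrite mem_enum inE; lia.
by rewrite IH /=; [rewrite -Sn addnA addnK | lia].
Qed.

Lemma uniq_basis L n : uniq (basis L n).
Proof.
elim: L n => [|L IH] n /=.
  by rewrite cats0 map_inj_uniq ?enum_uniq // => S T [].
rewrite cat_uniq map_inj_uniq ?enum_uniq // => [|S T [] //] /=.
apply/andP; split.
  apply/hasPn => p /allpairsPdep[b [q [_ _ ->]]]; apply/mapP => -[T _ [_]].
  by move/(congr1 size); rewrite size_rcons.
apply: allpairs_uniq_dep => [|b _|]; rewrite ?enum_uniq ?IH //.
by move=> [b [S w]] [b' [S' w']] /= _ _ [-> /rcons_inj[-> ->]].
Qed.

Definition betti n := size (basis n n).

Lemma size_basis L n : (n <= L)%N -> size (basis L n) = betti n.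
Proof.
move=> nL; apply/perm_size/uniq_perm; rewrite ?uniq_basis // => p.
by rewrite !mem_basis.
Qed.

(** Basis vectors are sorted by the last letter of the word, the binomial coefficient counting those
    with the empty word. This is Golod's formula in recursive form. *)
Lemma betti_rec n :
  betti n = ('C(e, n) + \sum_(b | (deg b < n)%N) betti (n - (deg b).+1))%N.
Proof.
rewrite -(@size_basis n.+1) //= size_cat size_map -cardE; congr addn.
  rewrite -[e in RHS]card_ord -card_draws; apply: eq_card => S.
  by rewrite !inE.
rewrite size_allpairs_dep sumnE big_map big_enum /=; apply: eq_bigr => b bn.
by rewrite size_basis //; lia.
Qed.

End Basis.

(** * The Golod complex in matrix form *)

Section MatrixResolution.
Variables (R : comNzRingType) (e : nat) (x : 'I_e -> R).
Variables (B : finType) (deg : B -> nat).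
Local Notation ext := {ffun {set 'I_e} -> R^o}.
Local Notation delta := (edelta x).
Variable gam : seq B -> ext.
Local Notation wt := (wt deg).
Local Notation b_ n := (betti e deg n).

Definition belt n (j : 'I_(b_ n)) := tnth (in_tuple (basis e deg n n)) j.

Lemma beltP n (j : 'I_(b_ n)) : (#|(belt j).1| + wt (belt j).2)%N = n.
Proof. by apply/eqP; rewrite -(@mem_basis _ _ _ n) // mem_tnth. Qed.

Lemma belt_inj n : injective (@belt n).
Proof. by apply/tuple_uniqP; apply: uniq_basis. Qed.

Lemma belt_surj n (p : {set 'I_e} * seq B) : (#|p.1| + wt p.2)%N = n ->
  exists j : 'I_(b_ n), belt j = p.
Proof.
move/eqP; rewrite -(@mem_basis _ _ _ n) // => /(@tnthP _ _ (in_tuple _))[j ->].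
by exists j.
Qed.

(** Inverse to [row_of] on the families of total degree n. *)
Definition family_of n (v : 'rV[R]_(b_ n)) : seq B -> ext :=
  fun w => [ffun S => \sum_j v 0 j * (belt j == (S, w))%:R].

Definition row_of n (f : seq B -> ext) : 'rV[R]_(b_ n) :=
  \row_j f (belt j).2 (belt j).1.

Lemma family_of_belt n (v : 'rV[R]_(b_ n)) j :
  family_of v (belt j).2 (belt j).1 = v 0 j.
Proof.
rewrite ffunE (bigD1 j) //= -surjective_pairing eqxx mulr1 big1 ?addr0 // => i ij.
by rewrite (inj_eq (@belt_inj n)) (negPf ij) mulr0.
Qed.

Lemma family_ofK n : cancel (@family_of n) (@row_of n).
Proof. by move=> v; apply/rowP => j; rewrite mxE family_of_belt. Qed.

Lemma Fdeg_family_of n (v : 'rV[R]_(b_ n)) : Fdeg deg n (family_of v).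
Proof.
move=> w S Sw; rewrite ffunE big1 // => j _; case: eqP => [jE|]; rewrite ?mulr0 //.
by have := beltP j; rewrite jE /= => E; rewrite E eqxx in Sw.
Qed.

Lemma row_ofK n f : Fdeg deg n f -> family_of (row_of n f) =1 f.
Proof.
move=> hf w; apply/ffunP => S; have [Sw|Sw] := eqVneq (#|S| + wt w)%N n; last first.
  by rewrite hf // (Fdeg_family_of _ Sw).
have [j jE] := @belt_surj n (S, w) Sw.
by have := family_of_belt (row_of n f) j; rewrite mxE jE.
Qed.

Lemma family_of_lin n r (u v : 'rV[R]_(b_ n)) :
  family_of (r *: u + v) =1 (fun w => r *: family_of u w + family_of v w).
Proof.
move=> w; apply/ffunP => S; rewrite !ffunE scaler_sumr -big_split.
by apply: eq_bigr => j _; rewrite !mxE mulrDl -mulrA.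
Qed.

Definition dmap n (v : 'rV[R]_(b_ n.+1)) : 'rV[R]_(b_ n) :=
  row_of n (rdiff x gam n.+1 (family_of v)).

Lemma dmap_linear n : linear (@dmap n).
Proof.
move=> r u v; apply/rowP => j; rewrite !mxE.
by rewrite (rdiff_ext _ _ _ (family_of_lin r u v)) rdiff_lin !ffunE.
Qed.

Definition dmx n : 'M[R]_(b_ n.+1, b_ n) := lin1_mx (@dmap n).

Hypothesis gam_delta : forall v, v != [::] -> delta (gam v) =
  - \sum_(1 <= i < size v) emul (bar (gam (take i v))) (gam (drop i v)).
Hypothesis gam_deg : forall v d, wt v = d.+1 -> edeg d (gam v).
Variables (k : fieldType) (iota : {rmorphism k -> R}) (M : R -> Prop).
Hypothesis M_span : forall r, M r <-> exists c : 'I_e -> R, r = \sum_i c i * x i.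
Hypothesis M_residue : forall r, exists c, M (r - iota c).
Hypothesis deg_gt0 : forall b, (0 < deg b)%N.
Hypothesis gam_free : forall d (a : B -> k) (y : ext), (0 < d)%N -> edeg d.+1 y ->
  \sum_(b | deg b == d) iota (a b) *: gam [:: b] = delta y ->
  forall b, deg b = d -> a b = 0.
Hypothesis gam_span : forall d (z : ext), (0 < d)%N -> edeg d z -> delta z = 0 ->
  exists (a : B -> k) (y : ext), edeg d.+1 y /\
    z = \sum_(b | deg b == d) iota (a b) *: gam [:: b] + delta y.
Hypothesis gam_M : forall v S, v != [::] -> M (gam v S).

Lemma mul_dmx n (u : 'rV[R]_(b_ n.+1)) : u *m dmx n = dmap u.
Proof. by rewrite mulmx_lin1 //; apply: dmap_linear. Qed.

Lemma family_of_dmx n (u : 'rV[R]_(b_ n.+1)) : family_of (u *m dmx n) =1 rdiff x gam n.+1 (family_of u).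
Proof.
move=> w; rewrite mul_dmx row_ofK //.
exact: (rdiff_deg x gam_deg _ (Fdeg_family_of u)).
Qed.

Lemma row_of_ext n (f g : seq B -> ext) : f =1 g -> row_of n f = row_of n g.
Proof. by move=> fg; apply/rowP => j; rewrite !mxE fg. Qed.

Lemma family_of0 n w : family_of (0 : 'rV[R]_(b_ n)) w = 0.
Proof. by apply/ffunP => S; rewrite !ffunE big1 // => j _; rewrite mxE mul0r. Qed.

Lemma dmx_exact n (v : 'rV[R]_(b_ n.+1)) : v *m dmx n = 0 <-> exists u, v = u *m dmx n.+1.
Proof.
have hv := Fdeg_family_of v; have bv := Fdeg_bounded hv (leqnn _).
(* [rdiff_exact] uses one truncation for v and for its preimage, which is one degree higher; [stab]
   passes from n + 1 to n + 2. *)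
have stab := rdiff_stable x gam bv (leqnSn _).
split=> [v0|[u uE]].
  have [|g hg gE] := rdiff_exact gam_delta gam_deg M_span M_residue deg_gt0
    gam_free gam_span hv (leqnn _).
    by move=> u; rewrite stab -family_of_dmx v0 family_of0.
  exists (row_of n.+2 g); rewrite mul_dmx -[v]family_ofK; apply: row_of_ext => w.
  by rewrite -gE; apply: rdiff_ext => w'; rewrite row_ofK.
rewrite mul_dmx -[RHS]family_ofK; apply: row_of_ext => w; rewrite family_of0 -stab.
rewrite (rdiff_ext _ _ _ (_ : _ =1 rdiff x gam n.+2 (family_of u))).
  by rewrite (rdiffK gam_delta) //; apply: Fdeg_bounded (Fdeg_family_of _) (leqnn _).
by move=> w'; rewrite uE family_of_dmx.
Qed.

Lemma dmx_M n i j : M (dmx n i j).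
Proof. by rewrite !mxE; apply: rdiff_M. Qed.

(** Degree 0 has a single basis vector, the empty set with the empty word, so this is the identity
    of R. *)
Definition augm : 'cV[R]_(b_ 0) := const_mx 1.

Lemma belt0 (j : 'I_(b_ 0)) : belt j = (set0, [::]).
Proof.
have := beltP j; case: (belt j) => S [|b w] //= /eqP; rewrite ?addn0.
  by rewrite cards_eq0 => /eqP->.
by rewrite addn_eq0 andbF.
Qed.

Lemma augmE (v : 'rV[R]_(b_ 0)) : (v *m augm) 0 0 = family_of v [::] set0.
Proof.
rewrite mxE ffunE; apply: eq_bigr => j _.
by rewrite belt0 eqxx mxE.
Qed.

Lemma augm_surj : exists v : 'rV[R]_(b_ 0), M (1 - (v *m augm) 0 0).
Proof.
exists (row_of 0 (one R e (B:=B))); rewrite augmE row_ofK; last exact: Fdeg_one.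
rewrite /one ffunE !eqxx subrr; apply/M_span; exists (fun=> 0).
by rewrite big1 // => i _; rewrite mul0r.
Qed.

Lemma augm_exact (v : 'rV[R]_(b_ 0)) : M ((v *m augm) 0 0) <-> exists u, v = u *m dmx 0.
Proof.
rewrite augmE; split=> [vM|[u ->]]; last first.
  by rewrite family_of_dmx; apply: rdiff_M.
have [g hg gE] := rdiff_exact0 gam M_span 1 (Fdeg_family_of v) vM.
exists (row_of 1 g); rewrite mul_dmx -[v]family_ofK; apply: row_of_ext => w.
by rewrite -gE; apply: rdiff_ext => w'; rewrite row_ofK.
Qed.

End MatrixResolution.

(** * Trivial Massey operations from a contractible ideal *)

Section Massey.
Variables (R : comNzRingType) (e : nat) (x : 'I_e -> R).
Variables (B : finType) (deg : B -> nat).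
Local Notation ext := {ffun {set 'I_e} -> R^o}.
Local Notation delta := (edelta x).
Local Notation wt := (wt deg).
Implicit Types (v : seq B) (a b : ext).
Variables (z : B -> ext) (N : ext -> Prop) (homotopy : ext -> ext).
Hypothesis z_deg : forall h : B, edeg (deg h) (z h).
Hypothesis z_cycle : forall h : B, delta (z h) = 0.
Hypothesis N0 : N 0.
Hypothesis N_lin : forall r a b, N a -> N b -> N (r *: a + b).
Hypothesis N_mull : forall a b, N b -> N (emul a b).
Hypothesis N_mulr : forall a b, N a -> N (emul a b).
Hypothesis N_zz : forall h h' : B, N (emul (z h) (z h')).
Hypothesis homotopyP : forall d a, edeg d a -> N a -> delta a = 0 ->
  [/\ N (homotopy a), edeg d.+1 (homotopy a) & delta (homotopy a) = a].

(** The first argument is fuel; the length of the word is enough, because every cut gives shorter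
    words. *)
Fixpoint massey_rec n v : ext :=
  if n is n'.+1 then
    if v is [:: b] then z b
    else homotopy (- \sum_(1 <= i < size v)
      emul (bar (massey_rec n' (take i v))) (massey_rec n' (drop i v)))
  else 0.

Definition massey v := massey_rec (size v) v.

Definition massey_sum v := \sum_(1 <= i < size v)
  emul (bar (massey (take i v))) (massey (drop i v)).

Lemma massey1 h : massey [:: h] = z h.
Proof. by []. Qed.

Lemma massey_recS n v : (1 < size v)%N -> massey_rec n.+1 v =
  homotopy (- \sum_(1 <= i < size v)
    emul (bar (massey_rec n (take i v))) (massey_rec n (drop i v))).
Proof. by case: v => [|b [|b' v]]. Qed.

Lemma cut_word v i : (0 < i < size v)%N -> [/\ take i v != [::], drop i v != [::],
  (size (take i v) < size v)%N & (size (drop i v) < size v)%N].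
Proof.
move=> /andP[i0 iv]; rewrite -!size_eq0 size_take size_drop iv.
by split; lia.
Qed.

Lemma massey_rec_stable n v : v != [::] -> (size v <= n)%N ->
  massey_rec n v = massey v.
Proof.
have [m] := ubnP (size v); elim: m n v => // m IH [|n] v vm v0 vn.
  by case: v v0 vn {vm}.
rewrite /massey; have [v1|v1] := leqP (size v) 1.
  by case: v v0 v1 {vm vn} => [|b []].
case E : (size v) => [|s]; first by rewrite E in v1.
rewrite !massey_recS //; congr (homotopy (- _)).
apply: eq_big_nat => i /cut_word[t0 d0 tv dv].
by rewrite !IH //; lia.
Qed.

Lemma masseyE v : (1 < size v)%N -> massey v = homotopy (- massey_sum v).
Proof.
move=> v1; rewrite /massey; case E : (size v) => [|s]; first by rewrite E in v1.
rewrite massey_recS //; congr (homotopy (- _)); apply: eq_big_nat => i /cut_word[t0 d0 tv dv].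
by rewrite !massey_rec_stable //; lia.
Qed.

Lemma wt_gt0 v : v != [::] -> (0 < wt v)%N.
Proof. by case: v. Qed.

Lemma N_opp a : N a -> N (- a).
Proof. by move=> Na; rewrite -scaleN1r -[_ *: _]addr0; apply: N_lin. Qed.

Lemma N_bar d a : edeg d a -> N a -> N (bar a).
Proof. by move=> /bar_edeg-> Na; rewrite -[_ *: _]addr0; apply: N_lin. Qed.

(* Both parts of the differential of massey_sum v are sums over the ways to cut v
   into three nonempty words. *)
Lemma massey_sum_cycle v :
  (forall u : seq B, u != [::] -> (size u < size v)%N -> delta (massey u) = - massey_sum u) ->
  delta (massey_sum v) = 0.
Proof.
move=> IH; rewrite /massey_sum edelta_sum.
pose A i j := emul (massey (take i v))
  (emul (bar (massey (drop i (take j v)))) (massey (drop j v))).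
rewrite (eq_big_nat _ _ (F2 := fun i => \sum_(1 <= j < i) A j i
    - \sum_(i.+1 <= j < size v) A i j)) => [|i /andP[i1 iv]].
  rewrite sumrB; apply/eqP; rewrite subr_eq0; apply/eqP.
  rewrite (eq_big_nat _ _ (F2 := fun i => \sum_(1 <= j < size v | (j < i)%N) A j i)).
    rewrite (exchange_big_dep_nat predT) //=; apply: eq_big_nat => j /andP[j1 jv].
    by rewrite [RHS](big_nat_widenl _ 1).
  by move=> i /andP[i1 iv]; rewrite (big_nat_widen _ _ (size v)) // ltnW.
have [t0 d0 tv dv] : [/\ take i v != [::], drop i v != [::],
    (size (take i v) < size v)%N & (size (drop i v) < size v)%N].
  by apply: cut_word; rewrite i1.
rewrite edelta_emul edelta_bar barK !IH //.
rewrite barN opprK emulNr; congr (_ - _).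
  rewrite /massey_sum bar_sum emul_suml size_take iv; apply: eq_big_nat => j /andP[j1 ji].
  by rewrite bar_emul barK take_takel ?(ltnW ji) // -emulA /A.
rewrite /massey_sum emul_sumr size_drop -[i.+1]add1n [RHS]big_addn.
apply: eq_big_nat => j /andP[j1 ji].
by rewrite /A take_drop drop_drop.
Qed.

(** Strong induction on the length: the sum over cuts lies in N and is a cycle by the equations for
    shorter words, so the contraction solves the equation inside N. *)
Lemma masseyP v : v != [::] -> [/\ edeg (wt v).-1 (massey v),
  (1 < size v)%N -> N (massey v) & delta (massey v) = - massey_sum v].
Proof.
have [m] := ubnP (size v); elim: m v => // m IH v vm v0.
have [v1|v1] := leqP (size v) 1.
  case: v v1 v0 {vm} => [|b []] // _ _; split=> //.
    by rewrite /wt /= addn0; apply: z_deg.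
  by rewrite z_cycle /massey_sum big_geq ?oppr0.
have {}IH (u : seq B) : u != [::] -> (size u < size v)%N -> [/\ edeg (wt u).-1 (massey u),
    (1 < size u)%N -> N (massey u) & delta (massey u) = - massey_sum u].
  by move=> u0 uv; apply: IH => //; lia.
have cyc : delta (massey_sum v) = 0.
  by apply: massey_sum_cycle => u u0 uv; have [] := IH u u0 uv.
have degS : edeg (wt v).-2 (massey_sum v).
  rewrite /massey_sum big_nat_cond; apply: edeg_sum => i /andP[/cut_word[t0 d0 tv dv] _].
  have [dt _ _] := IH _ t0 tv; have [dd _ _] := IH _ d0 dv.
  have -> : (wt v).-2 = ((wt (take i v)).-1 + (wt (drop i v)).-1)%N.
    rewrite -{1}(cat_take_drop i v) wt_cat.
    by have := wt_gt0 t0; have := wt_gt0 d0; lia.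
  by apply: edeg_emul => //; apply: edeg_bar.
have NS : N (massey_sum v).
  rewrite /massey_sum big_nat_cond; elim/big_ind: _ => // [a b Na Nb|i].
    by rewrite -[a]scale1r; apply: N_lin.
  move=> /andP[/cut_word[t0 d0 tv dv] _].
  have [dt Nt _] := IH _ t0 tv; have [_ Nd _] := IH _ d0 dv.
  (* A factor with at least two letters is already in N; if both factors are single letters, [N_zz]
     applies. *)
  have [d1|/Nd] := leqP (size (drop i v)) 1; last exact: N_mull.
  have [t1|/Nt Nt1] := leqP (size (take i v)) 1; last by apply/N_mulr/(N_bar dt).
  case: (take i v) t0 t1 dt {tv Nt} => [|b []] // _ _ db.
  case: (drop i v) d0 d1 {dv Nd} => [|b' []] // _ _.
  rewrite !massey1 in db *; rewrite (bar_edeg db) emulZl -[_ *: _]addr0.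
  exact: N_lin.
have [|||h1 h2 h3] := @homotopyP (wt v).-2 (- massey_sum v).
- exact: edegN.
- exact: N_opp.
- by rewrite edeltaN cyc oppr0.
rewrite masseyE //; split=> //.
suff -> : (wt v).-1 = (wt v).-2.+1 by [].
by have := size_le_wt deg v; lia.
Qed.

End Massey.

(** * Quotients by monomial ideals *)

Section MonomialQuotient.
Variables (k : fieldType) (n : nat) (I : idealr {mpoly k[n]}) (G : seq 'X_{1..n}).
Hypothesis k0 : [pchar k] =i pred0.
Hypothesis IG : generates G I.
Local Notation R := {ideal_quot I}.
Implicit Types (m g : 'X_{1..n}) (p q : {mpoly k[n]}) (r s : R).

Lemma generated_coef p m : generated_by G p -> p@_m != 0 ->
  exists2 g, g \in G & (g <= m)%MM.
Proof.
case=> c ->; rewrite raddf_sum /= => /eqP nz.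
have [/hasP[g gG gm]|/hasPn h] := boolP (has (fun g => (g <= m)%MM) G); first by exists g.
case: nz; rewrite big_seq big1 // => g gG; apply/eqP; rewrite mcoeff_eq0.
by rewrite (perm_mem (msuppMX _ _)); apply/mapP => -[m' _ mE];
  move: (h g gG); rewrite mE lem_addr.
Qed.

Lemma generator_in g : g \in G -> 'X_[g] \in I.
Proof.
move=> gG; apply/IG.
(* G may repeat g *)
exists (fun g' => if g' == g then ((count_mem g G)%:R^-1)%:MP else 0).
rewrite (eq_bigr (fun g' => if g' == g then ((count_mem g G)%:R^-1)%:MP * 'X_[g] else 0)).
  rewrite -big_mkcond big_const_seq iter_addr_0 mul_mpolyC scalerMnl -[_ *+ _]mulr_natl.
  rewrite divff ?scale1r // ((pcharf0P k).1 k0) -lt0n -has_count.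
  by apply/hasP; exists g => /=.
by move=> g' _; case: eqP => [->//|_]; rewrite mul0r.
Qed.

Lemma XI_gen m : reflect (exists2 g, g \in G & (g <= m)%MM) ('X_[m] \in I).
Proof.
apply: (iffP idP) => [/IG/generated_coef|[g gG gm]].
  by apply; rewrite mcoeffX eqxx oner_neq0.
by rewrite -(submK gm) mpolyXD idealMr // generator_in.
Qed.

Lemma XI_le m m' : (m <= m')%MM -> 'X_[m] \in I -> 'X_[m'] \in I.
Proof.
by move=> mm' /XI_gen[g gG gm]; apply/XI_gen; exists g => //; apply: lepm_trans gm mm'.
Qed.

Lemma memI_coef p : reflect (forall m, p@_m != 0 -> 'X_[m] \in I) (p \in I).
Proof.
apply: (iffP idP) => [/IG pG m pm|h]; first by apply/XI_gen; apply: generated_coef pm.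
rewrite [p]mpolyE big_seq rpred_sum // => m; rewrite mcoeff_msupp => pm.
by rewrite -mul_mpolyC idealMr // h.
Qed.

Lemma X0_notin : 'X_[0] \notin I.
Proof. by rewrite mpolyX0 idealr1. Qed.

Lemma proj_eq p q : (proj I p == proj I q) = (p - q \in I).
Proof. by rewrite Quotient.idealrBE. Qed.

Lemma projD p q : proj I (p + q) = proj I p + proj I q.
Proof. by rewrite /proj rmorphD. Qed.

Lemma projM p q : proj I (p * q) = proj I p * proj I q.
Proof. by rewrite /proj rmorphM. Qed.

Lemma proj0 : proj I 0 = 0.
Proof. by rewrite /proj rmorph0. Qed.

Lemma proj_repr r : proj I (repr r) = r.
Proof. exact: reprK. Qed.

Definition scalar_rmorph : {rmorphism k -> R} := (\pi_R%qT \o @mpolyC n k)%FUN.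

Lemma scalar_rmorphE a : scalar_rmorph a = scalar I a.
Proof. by []. Qed.

(* Normal form: the coefficient in r of a monomial outside I. *)
Definition rcoef r m : k := if 'X_[m] \in I then 0 else (repr r)@_m.

(** Two representatives differ by an element of I, all of whose monomials lie in I, so the choice
    made by [repr] does not matter outside I. *)
Lemma rcoef_proj p m : rcoef (proj I p) m = if 'X_[m] \in I then 0 else p@_m.
Proof.
rewrite /rcoef; case: (boolP ('X_[m] \in I)) => // mI; apply/eqP.
rewrite -subr_eq0 -mcoeffB; apply: contraNT mI; apply/memI_coef.
by rewrite -proj_eq proj_repr.
Qed.

Lemma rcoef_in r m : 'X_[m] \in I -> rcoef r m = 0.
Proof. by rewrite /rcoef => ->. Qed.

Lemma rcoef_notin r m : rcoef r m != 0 -> 'X_[m] \notin I.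
Proof. by apply: contraNN => /rcoef_in->. Qed.

Lemma rcoefD r s m : rcoef (r + s) m = rcoef r m + rcoef s m.
Proof.
rewrite -[r]proj_repr -[s]proj_repr -projD !rcoef_proj; case: ifP => _.
  by rewrite addr0.
by rewrite mcoeffD.
Qed.

Lemma rcoef0 m : rcoef 0 m = 0.
Proof. by rewrite -proj0 rcoef_proj mcoeff0; case: ifP. Qed.

Lemma rcoefN r m : rcoef (- r) m = - rcoef r m.
Proof. by apply/eqP; rewrite -addr_eq0 -rcoefD addNr rcoef0. Qed.

Lemma rcoef_sum (X : Type) (t : seq X) (P : pred X) (F : X -> R) m :
  rcoef (\sum_(i <- t | P i) F i) m = \sum_(i <- t | P i) rcoef (F i) m.
Proof. by elim/big_rec2: _ => [|i y1 y2 _ <-]; rewrite ?rcoef0 ?rcoefD. Qed.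

Lemma rcoef_scalar a r m : rcoef (scalar I a * r) m = a * rcoef r m.
Proof.
rewrite -[r]proj_repr -projM !rcoef_proj; case: ifP => _; first by rewrite mulr0.
by rewrite mcoeffCM.
Qed.

Lemma rcoef_sign (b : nat) r m : rcoef ((-1) ^+ b * r) m = (-1) ^+ b * rcoef r m.
Proof. by rewrite -rcoef_scalar -scalar_rmorphE rmorphXn rmorphN1. Qed.

Lemma rcoef_inj r s : rcoef r =1 rcoef s -> r = s.
Proof.
move=> rs; apply/eqP; rewrite -subr_eq0 -(proj_repr (r - s)) -proj0 proj_eq subr0.
apply/memI_coef => m; apply: contraNT => mI.
have := rcoefD r (- s) m; rewrite rcoefN rs subrr /rcoef (negPf mI).
by move->.
Qed.

Lemma rcoefM_X r i m : rcoef (r * proj I 'X_i) m =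
  if ('X_[m] \in I) || (m i == 0%N) then 0 else rcoef r (m - U_(i)).
Proof.
rewrite -[r in LHS]proj_repr -projM rcoef_proj; case: ifP => //= mI.
have [mi|mi] := eqVneq (m i) 0%N.
  apply/eqP; rewrite mcoeff_eq0 (perm_mem (msuppMX _ _)); apply/mapP => -[m' _ mE].
  by move: mi; rewrite mE mnmDE mnm1E eqxx.
have Um : (U_(i) <= m)%MM by rewrite lep1mP.
rewrite -{1}(submK Um) addmC mcoeffMX /rcoef ifF //.
by apply: contraFF mI; apply: XI_le; apply: lem_subr.
Qed.

Lemma rcoefM_supp r s m : rcoef (r * s) m != 0 -> exists m1 m2,
  [/\ m = (m1 + m2)%MM, rcoef r m1 != 0 & rcoef s m2 != 0].
Proof.
rewrite -[r in r * _]proj_repr -[s in _ * s]proj_repr -projM rcoef_proj.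
case: ifP => mI; rewrite ?eqxx // -mcoeff_msupp => /msuppM_le/allpairsP[[m1 m2] /=].
rewrite !mcoeff_msupp => -[h1 h2 mE]; exists m1, m2; split=> //.
  by rewrite /rcoef ifF //; apply: contraFF mI; apply: XI_le; rewrite mE lem_addr.
by rewrite /rcoef ifF //; apply: contraFF mI; apply: XI_le; rewrite mE lem_addl.
Qed.

Lemma rcoef_bound r m : rcoef r m != 0 -> (mdeg m < msize (repr r))%N.
Proof.
rewrite /rcoef; case: ifP; rewrite ?eqxx // => _.
by rewrite -mcoeff_msupp; apply: msize_mdeg_lt.
Qed.

Definition of_coefs d (c : 'X_{1..n} -> k) : R :=
  proj I (\sum_(m : 'X_{1..n < d}) c m *: 'X_[m]).

Lemma rcoef_of_coefs d c m : rcoef (of_coefs d c) m =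
  if ('X_[m] \in I) || (d <= mdeg m)%N then 0 else c m.
Proof.
rewrite rcoef_proj; case: ifP => //= _; case: leqP => dm; last by rewrite (mcoeff_mpoly c).
rewrite (raddf_sum (mcoeff m)) big1 //= => m' _; rewrite mcoeffZ mcoeffX.
case: eqP => [mE|]; rewrite ?mulr0 //.
by have := bmdeg m'; rewrite mE ltnNge dm.
Qed.

End MonomialQuotient.

(** * Multidegrees of the Koszul complex *)

Lemma sumr_neq0 (V : zmodType) (J : finType) (F : J -> V) :
  \sum_j F j != 0 -> exists j, F j != 0.
Proof.
move=> nz; apply/existsP; apply: contraNT nz; rewrite negb_exists => /forallP h.
by rewrite big1 // => j _; apply/eqP; rewrite -[_ == 0]negbK; apply: h.
Qed.

Section Multigraded.
Variables (k : fieldType) (n : nat) (I : idealr {mpoly k[n]}) (G : seq 'X_{1..n}).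
Hypothesis k0 : [pchar k] =i pred0.
Hypothesis IG : generates G I.
Local Notation R := {ideal_quot I}.
Variables (e : nat) (vi : 'I_e -> 'I_n).
Hypothesis vi_inj : injective vi.
Hypothesis vi_codom : forall c, 'X_c \notin I -> exists j, vi j = c.
Local Notation xv := (fun j => proj I 'X_(vi j)).
Local Notation ext := {ffun {set 'I_e} -> R^o}.
Local Notation delta := (edelta xv).
Local Notation l := (lcm_monomials G).
Hypothesis golodI : forall (i j : 'I_n) (m m' : 'X_{1..n}), i != j ->
  'X_[m + U_(i)] \in I -> 'X_[m' + U_(j)] \in I -> (m + m' <= l)%MM ->
  'X_[m + m'] \in I.
Implicit Types (m a : 'X_{1..n}) (S T U : {set 'I_e}) (w : ext) (i j : 'I_e).

Lemma gen_le_lcm g : g \in G -> (g <= l)%MM.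
Proof.
rewrite /lcm_monomials; elim: G => // g' G' IH; rewrite inE big_cons => /orP[/eqP->|gG].
  exact: lem_mlcml.
exact: lepm_trans (IH gG) (lem_mlcmr _ _).
Qed.

(** A generator dividing m x_c has exponent at most l_c <= m_c in x_c, so it divides m. *)
Lemma XI_shift m (c : 'I_n) : (l c <= m c)%N -> 'X_[m + U_(c)] \in I -> 'X_[m] \in I.
Proof.
move=> lm /(XI_gen k0 IG)[g gG /mnm_lepP gm]; apply/(XI_gen k0 IG); exists g => //.
apply/mnm_lepP => c'; have := gm c'; rewrite mnmDE mnm1E.
have [<- _|_] := eqVneq c c'; last by rewrite addn0.
by apply: leq_trans lm; move/mnm_lepP: (gen_le_lcm gG).
Qed.

(** The multidegree of e_S. *)
Definition mon S : 'X_{1..n} := (\sum_(j in S) U_(vi j))%MM.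

Lemma monE S j : mon S (vi j) = (j \in S).
Proof.
rewrite /mon mnm_sumE; have [jS|jS] := boolP (j \in S).
  rewrite (bigD1 j) //= mnm1E eqxx big1 // => i /andP[_ ij].
  by rewrite mnm1E (inj_eq vi_inj) (negPf ij).
rewrite big1 // => i iS; rewrite mnm1E (inj_eq vi_inj).
by case: eqP iS => // ->; rewrite (negPf jS).
Qed.

Lemma monU S T : [disjoint S & T] -> mon (S :|: T) = (mon S + mon T)%MM.
Proof. by move=> ST; rewrite /mon -bigU //; apply: eq_bigl => s; rewrite !inE. Qed.

Lemma monU1 j T : j \notin T -> mon (j |: T) = (U_(vi j) + mon T)%MM.
Proof. by move=> jT; rewrite monU ?disjU1 // {1}/mon big_set1. Qed.

(* The component of w in multidegree a. *)
Definition cc w a S : k := if (mon S <= a)%MM then rcoef (w S) (a - mon S) else 0.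

Lemma rcoef_cc w S m : rcoef (w S) m = cc w (m + mon S) S.
Proof. by rewrite /cc lem_addl addmK. Qed.

Lemma cc_inj w w' : (forall a S, cc w a S = cc w' a S) -> w = w'.
Proof. by move=> h; apply/ffunP => S; apply: (rcoef_inj k0 IG) => m; rewrite !rcoef_cc h. Qed.

(** The condition for x^(a - mon S) e_S to be a nonzero basis vector of the complex in multidegree
    a. *)
Definition std a S := (mon S <= a)%MM && ('X_[a - mon S] \notin I).

Lemma cc_std w a S : cc w a S != 0 -> std a S.
Proof.
rewrite /cc /std; case: ifP; rewrite ?eqxx //= => _.
exact: rcoef_notin.
Qed.

Lemma ccD w w' a S : cc (w + w') a S = cc w a S + cc w' a S.
Proof. by rewrite /cc ffunE (rcoefD k0 IG); case: ifP; rewrite ?addr0. Qed.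

Lemma ccN w a S : cc (- w) a S = - cc w a S.
Proof. by rewrite /cc ffunE (rcoefN k0 IG); case: ifP; rewrite ?oppr0. Qed.

Lemma cc0 a S : cc 0 a S = 0.
Proof. by rewrite /cc ffunE (rcoef0 k0 IG); case: ifP. Qed.

Lemma ccZ c w a S : cc (scalar I c *: w) a S = c * cc w a S.
Proof.
by rewrite /cc ffunE /GRing.scale /= (rcoef_scalar k0 IG); case: ifP; rewrite ?mulr0.
Qed.

Hypothesis vi_notin : forall j, 'X_(vi j) \notin I.

Lemma std_out a S c : std a S -> 'X_c \in I -> a c = 0%N.
Proof.
case/andP=> Sa aI cI; apply/eqP; apply: contraNT aI => ac.
apply: (XI_le k0 IG _ cI); rewrite lep1mP mnmBE.
suff -> : mon S c = 0%N by rewrite subn0.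
rewrite /mon mnm_sumE big1 // => j jS; rewrite mnm1E; case: eqP => // vjc.
by have := vi_notin j; rewrite vjc cI.
Qed.

(** Within one multidegree the exponents determine the factors x_j, so only signs are left, as in a
    simplicial boundary. *)
Lemma cc_delta w a T : cc (delta w) a T =
  if std a T then \sum_(j | j \notin T) sg k [set j] T * cc w a (j |: T) else 0.
Proof.
rewrite /cc /std; case: (boolP (mon T <= a)%MM) => //= Ta.
case: (boolP (_ \in I)) => /= aI; first by rewrite rcoef_in.
rewrite ffunE (rcoef_sum k0 IG); apply: eq_bigr => j jT.
rewrite -mulrA (rcoef_sign k0 IG) -sg1; congr (_ * _).
rewrite mulrC (rcoefM_X k0 IG) (negPf aI) /= monU1 // addmC submDA.
(* The product with x_j reaches this monomial exactly when e_j e_T still fits below a. *)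
have -> : ((a - mon T)%MM (vi j) == 0%N) = ~~ (mon T + U_(vi j) <= a)%MM.
  rewrite mnmBE monE (negPf jT) subn0; apply/eqP/idP => [aj|].
    by apply/mnm_lepP => /(_ (vi j)); rewrite mnmDE monE mnm1E eqxx (negPf jT) aj.
  apply: contraNeq => aj; apply/mnm_lepP => c; rewrite mnmDE mnm1E.
  case: eqP => [<-|_]; first by rewrite monE (negPf jT) lt0n.
  by rewrite addn0; apply/mnm_lepP.
by case: (mon T + _ <= a)%MM.
Qed.

Definition pivot a : option 'I_e :=
  if [pick j | (l (vi j) < a (vi j))%N] is Some j then Some j
  else [pick j | (0 < a (vi j))%N].

Lemma pivot_gt0 a i : pivot a = Some i -> (0 < a (vi i))%N.
Proof.
rewrite /pivot; case: pickP => [j lj [<-]|_]; first exact: leq_ltn_trans lj.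
by case: pickP => // j aj [<-].
Qed.

Lemma pivot_big a j : (l (vi j) < a (vi j))%N ->
  exists2 i, pivot a = Some i & (l (vi i) < a (vi i))%N.
Proof.
by rewrite /pivot; case: pickP => [i li _|/(_ j)->//]; exists i.
Qed.

Lemma pivot_exists a S : (mon S <= a)%MM -> S != set0 -> exists i, pivot a = Some i.
Proof.
move=> Sa /set0Pn[j jS]; rewrite /pivot; case: pickP => [i _|_]; first by exists i.
case: pickP => [i _|/(_ j)/negP[]]; first by exists i.
by move/mnm_lepP: Sa => /(_ (vi j)); rewrite monE jS.
Qed.

Definition homotopy_coef w a S : k :=
  if pivot a is Some i then
    if i \in S then sg k [set i] (S :\ i) * cc w a (S :\ i) else 0
  else 0.

(* In multidegree a this is left multiplication by e_i / x_i with i = pivot a. *)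
Definition homotopy w : ext := [ffun S =>
  of_coefs I (\max_T msize (repr (w T))) (fun m => homotopy_coef w (m + mon S) S)].

Lemma cc_homotopy w a S : cc (homotopy w) a S = if std a S then homotopy_coef w a S else 0.
Proof.
rewrite /cc /std ffunE; case: (boolP (mon S <= a)%MM) => //= Sa.
rewrite (rcoef_of_coefs k0 IG) submK //; case: (boolP (_ \in I)) => //= aI.
case: leqP => // bound; rewrite /homotopy_coef; case: (pivot a) => // i; case: ifP => // iS.
rewrite /cc; case: ifP => Sia; last by rewrite mulr0.
(* The truncation in [homotopy] cuts nothing off: past it, the coefficient of w one degree higher is
   already zero. *)
suff -> : rcoef (w (S :\ i)) (a - mon (S :\ i)) = 0 by rewrite mulr0.
apply/eqP; apply: contraTT bound => /rcoef_bound h; rewrite -ltnNge.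
have aE : (a - mon (S :\ i) = a - mon S + U_(vi i))%MM.
  have := submK Sa; rewrite -{2}(setD1K iS) monU1 ?setD11 // addmA => {1}<-.
  by rewrite addmK.
rewrite aE mdegD mdeg1 in h.
have := leq_bigmax (F := fun T : {set 'I_e} => msize (repr (w T))) (S :\ i).
by apply: leq_trans; rewrite -addn1 ltnW.
Qed.

Lemma homotopy_deg d w : edeg d w -> edeg d.+1 (homotopy w).
Proof.
move=> dw S Sd; apply: (rcoef_inj k0 IG) => m; rewrite rcoef_cc cc_homotopy (rcoef0 k0 IG).
case: ifP => // _; rewrite /homotopy_coef; case: (pivot _) => // i; case: ifP => // iS.
rewrite /cc dw ?(rcoef0 k0 IG); first by case: ifP; rewrite mulr0.
by move: Sd; rewrite (cardsD1 i S) iS add1n eqSS.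
Qed.

Lemma homotopy0 : homotopy 0 = 0.
Proof.
apply: cc_inj => a S; rewrite cc_homotopy /homotopy_coef !cc0; case: ifP => // _.
by case: (pivot a) => // i; rewrite cc0 mulr0 if_same.
Qed.

(** Homotopic to the identity, so it replaces a cycle by a homologous one with the support described
    in [near_part_supp]. *)
Definition near_part w := w - delta (homotopy w) - homotopy (delta w).

Lemma near_part_deg d w : edeg d w -> edeg d (near_part w).
Proof.
move=> dw; apply: edegD; first (apply: edegD => //; first exact/edegN/edeg_edelta/homotopy_deg).
apply: edegN; case: d dw => [|d] dw; last exact/homotopy_deg/edeg_edelta.
by rewrite edelta_edeg0 // homotopy0; apply: edeg0.
Qed.

Lemma std_add a T i : std a T -> (0 < a (vi i))%N -> std a (i |: T).
Proof.
case/andP=> Ta aI ai; have [iT|iT] := boolP (i \in T).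
  by rewrite (setUidPr _) ?sub1set // /std Ta.
have iTa : (mon (i |: T) <= a)%MM.
  rewrite monU1 //; apply/mnm_lepP => c; rewrite mnmDE mnm1E.
  case: eqP => [<-|_]; first by rewrite monE (negPf iT) addn0.
  by rewrite add0n; apply/mnm_lepP.
rewrite /std iTa /=; apply: contraNN aI; apply: (XI_le k0 IG).
by rewrite monU1 // addmC -submDA lem_subr.
Qed.

Lemma ccB w w' a S : cc (w - w') a S = cc w a S - cc w' a S.
Proof. by rewrite ccD ccN. Qed.

(** In every other position the homotopy h satisfies delta h + h delta = 1: inserting and removing i
    returns w, and the terms that move another index vanish or cancel by anticommutativity. *)
Lemma near_part_supp w a S i : pivot a = Some i -> cc (near_part w) a S != 0 ->
  i \in S /\ 'X_[a - mon S + U_(vi i)] \in I.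
Proof.
move=> ai prj0; have aS := cc_std prj0; have ai0 := pivot_gt0 ai.
move: prj0; rewrite /near_part !ccB cc_delta cc_homotopy aS /homotopy_coef ai.
have [iS|iS] := boolP (i \in S); last first.
  rewrite subr0 (bigD1 i) //= cc_homotopy std_add // /homotopy_coef ai setU11 setU1K //.
  rewrite mulrA sg_sqr mul1r big1 ?addr0 ?subrr ?eqxx // => j /andP[jS ji].
  rewrite cc_homotopy /homotopy_coef ai !inE eq_sym (negPf ji) (negPf iS).
  by case: ifP; rewrite mulr0.
pose S' := S :\ i; have iS' : i \notin S' by rewrite setD11.
have SE : S = i |: S' by rewrite setD1K.
case: (boolP (_ \in I)) => // aI.
have aS' : std a S'.
  have /andP[Sa _] := aS; have aE : (a - mon S' = a - mon S + U_(vi i))%MM.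
    by have := submK Sa; rewrite {2}SE monU1 // addmA => {1}<-; rewrite addmK.
  rewrite /std aE aI andbT; apply: lepm_trans Sa.
  by rewrite SE monU1 // lem_addl.
rewrite -/S' cc_delta aS' (bigD1 i iS') /= -SE mulrDr mulrA sg_sqr mul1r.
suff -> : \sum_(j | j \notin S) sg k [set j] S * cc (homotopy w) a (j |: S) =
    - (sg k [set i] S' * \sum_(j | (j \notin S') && (j != i))
      sg k [set j] S' * cc w a (j |: S')).
  by rewrite opprK subrr eqxx.
rewrite mulr_sumr -sumrN; apply: eq_big => [j|j jS].
  by rewrite SE !inE negb_or andbC; case: eqP.
have ji : j != i by apply: contraNneq jS => ->.
have jS' : j \notin S' by rewrite !inE negb_and jS orbT.
have ijS' : i \notin j |: S' by rewrite in_setU1 eq_sym negb_or ji iS'.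
have jSE : j |: S = i |: (j |: S') by rewrite setUCA -SE.
rewrite cc_homotopy /homotopy_coef ai jSE setU11 setU1K //.
rewrite (_ : (if _ then _ else 0) = sg k [set i] (j |: S') * cc w a (j |: S')); last first.
  case: ifP => // /negbT; have [->|/cc_std/std_add/(_ ai0)->//] := eqVneq (cc w a (j |: S')) 0.
  by rewrite mulr0.
have -> : sg k [set j] S = sg k [set j] [set i] * sg k [set j] S'.
  by rewrite {1}SE sgUr ?disjU1.
have -> : sg k [set i] (j |: S') = sg k [set i] [set j] * sg k [set i] S'.
  by rewrite sgUr ?disjU1.
rewrite (sg11 k ji); have := sg_sqr k [set i] [set j].
set p := sg _ _ _ => p2; set q := sg _ _ _; set r := sg _ _ _; set c := cc _ _ _.
by rewrite -[RHS]mul1r -p2; ring.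
Qed.

(** The pivot i then has a_i > l_i, and [XI_shift] turns the condition of [near_part_supp] into x^(a
    - mon S) being in I. *)
Lemma near_part_big w a S j : (l (vi j) < a (vi j))%N -> cc (near_part w) a S = 0.
Proof.
move=> /pivot_big[i ai li]; apply/eqP/negPn/negP => nz.
have [iS aI] := near_part_supp ai nz; have /andP[_ /negP[]] := cc_std nz.
apply: XI_shift aI; rewrite mnmBE monE iS; lia.
Qed.

(* Multidegrees in which the homotopy makes the Koszul complex contractible; the
   maximum with 1 puts [far] inside the maximal ideal. *)
Definition far w := forall a S, cc w a S != 0 ->
  exists j, (maxn (l (vi j)) 1 < a (vi j))%N.

Lemma far0 : far 0.
Proof. by move=> a S; rewrite cc0 eqxx. Qed.

Lemma emul_supp w w' a U : cc (emul w w') a U != 0 -> exists S T b c,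
  [/\ [disjoint S & T], a = (b + c)%MM, cc w b S != 0, cc w' c T != 0 & U = S :|: T].
Proof.
move=> nz; have /andP[Ua _] := cc_std nz.
have {nz} : rcoef (emul w w' U) (a - mon U) != 0 by move: nz; rewrite /cc Ua.
rewrite /emul locked_withE sum_ffunE (rcoef_sum k0 IG) => /sumr_neq0[S].
rewrite sum_ffunE (rcoef_sum k0 IG) => /sumr_neq0[T].
rewrite /ebmul; case: ifP => ST; last by rewrite scaler0 ffunE (rcoef0 k0 IG) eqxx.
rewrite !ffunE; case: (eqVneq U (S :|: T)) => US; last first.
  by rewrite !scaler0 (rcoef0 k0 IG) eqxx.
rewrite /GRing.scale /= mulr1 mulrC; have [d ->] := sg_expr R S T.
rewrite (rcoef_sign k0 IG) mulf_eq0 negb_or => /andP[_].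
move=> /(rcoefM_supp k0 IG)[m1 [m2 [mE nz1 nz2]]].
exists S, T, (m1 + mon S)%MM, (m2 + mon T)%MM; split; rewrite -?rcoef_cc //.
rewrite -(submK Ua) mE US monU //.
by apply/mnmP => c; rewrite !mnmDE addnACA.
Qed.

Lemma far_mull w w' : far w' -> far (emul w w').
Proof.
move=> fw a U /emul_supp[S [T [b [c [_ -> _ /fw[j cj] _]]]]].
by exists j; rewrite mnmDE; apply: leq_trans cj (leq_addl _ _).
Qed.

Lemma far_mulr w w' : far w -> far (emul w w').
Proof.
move=> fw a U /emul_supp[S [T [b [c [_ -> /fw[j cj] _ _]]]]].
by exists j; rewrite mnmDE; apply: leq_trans cj (leq_addr _ _).
Qed.

Lemma ccZr r w a S : cc (r *: w) a S != 0 -> exists2 b, (b <= a)%MM & cc w b S != 0.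
Proof.
move=> nz; have /andP[Sa _] := cc_std nz.
have : rcoef (r * w S) (a - mon S) != 0 by move: nz; rewrite /cc Sa ffunE.
move=> /(rcoefM_supp k0 IG)[m1 [m2 [mE _ nz2]]].
exists (m2 + mon S)%MM; last by rewrite -rcoef_cc.
by rewrite -(submK Sa) mE -addmA lem_addl.
Qed.

Lemma far_lin r w w' : far w -> far w' -> far (r *: w + w').
Proof.
move=> fw fw' a S; rewrite ccD; have [->|nz _] := eqVneq (cc (r *: w) a S) 0.
  by rewrite add0r; apply: fw'.
have [b ba /fw[j bj]] := ccZr nz; exists j; apply: leq_trans bj _.
by apply/mnm_lepP.
Qed.

Lemma far_homotopy w : far w -> far (homotopy w).
Proof.
move=> fw a S; rewrite cc_homotopy /homotopy_coef; case: ifP; rewrite ?eqxx // => _.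
case: (pivot a); rewrite ?eqxx // => i; case: ifP; rewrite ?eqxx // => iS.
by rewrite mulf_eq0 negb_or => /andP[_ /fw].
Qed.

(** In the multidegrees allowed by [far], [near_part] vanishes by [near_part_big]; in all others w
    and its homotopy have no component. *)
Lemma far_contract w : far w -> delta w = 0 -> delta (homotopy w) = w.
Proof.
move=> fw dw; apply/esym/eqP; rewrite -subr_eq0; apply/eqP.
have -> : w - delta (homotopy w) = near_part w by rewrite /near_part dw homotopy0 subr0.
apply: cc_inj => a S; rewrite cc0.
have [/existsP[j aj]|/existsPn h] := boolP [exists j, (maxn (l (vi j)) 1 < a (vi j))%N].
  by apply: (@near_part_big _ _ _ j); apply: leq_ltn_trans aj; apply: leq_maxl.
have w0 T : cc w a T = 0.
  by apply/eqP; apply: contraT => /fw[j aj]; have := h j; rewrite aj.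
have h0 T : cc (homotopy w) a T = 0.
  rewrite cc_homotopy /homotopy_coef; case: ifP => // _; case: (pivot a) => // i.
  by rewrite w0 mulr0 if_same.
rewrite /near_part dw homotopy0 subr0 ccB w0 cc_delta big1 ?if_same ?subr0 // => j _.
by rewrite h0 mulr0.
Qed.

(* Representatives of homology: coefficients f / x_i with f in I, in
   multidegrees a dividing the lcm, and containing e_i for i = pivot a. *)
Definition near w := forall a S, cc w a S != 0 -> (a <= l)%MM /\
  exists i, [/\ pivot a = Some i, i \in S & 'X_[a - mon S + U_(vi i)] \in I].

(** The bound by l comes from [near_part_big] for variables outside I, the others having exponent 0.
    Positive degree makes S nonempty, so a pivot exists. *)
Lemma near_part_is_near d w : edeg d.+1 w -> near (near_part w).
Proof.
move=> dw a S nz; have aS := cc_std nz; have /andP[Sa _] := aS.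
have S0 : S != set0.
  apply: contraNneq nz => S0; rewrite /cc Sa (near_part_deg dw) ?(rcoef0 k0 IG) //.
  by rewrite S0 cards0.
have [i ai] := pivot_exists Sa S0; split; last first.
  by exists i; split=> //; have [] := near_part_supp ai nz.
apply/mnm_lepP => c; have [cI|/vi_codom[j <-]] := boolP ('X_c \in I).
  by rewrite (std_out aS).
by rewrite leqNgt; apply: contraNN nz => /near_part_big->.
Qed.

(** The pivots of the factors lie in disjoint sets, hence differ. If the multidegree were not far,
    the product of the two monomials would divide l, and [golodI] would put it in I. *)
Lemma near_mul w w' : near w -> near w' -> far (emul w w').
Proof.
move=> gw gw' a U nz; have aU := cc_std nz.
have [S [T [b [c [ST aE nzb nzc UE]]]]] := emul_supp nz.
have [bl [i [bi iS bI]]] := gw _ _ nzb; have [cl [j [cj jT cI]]] := gw' _ _ nzc.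
have ij : vi i != vi j.
  rewrite (inj_eq vi_inj); apply: contraTneq jT => <-.
  by have := disjointFr ST iS => ->.
have /andP[Sb _] := cc_std nzb; have /andP[Tc _] := cc_std nzc.
have mE : (b - mon S + (c - mon T) = a - mon U)%MM.
  rewrite UE monU // aE; apply/mnmP => x.
  move/mnm_lepP: Sb => /(_ x); move/mnm_lepP: Tc => /(_ x).
  rewrite !(mnmDE, mnmBE); move: (b x) (c x) (mon S x) (mon T x); clear; lia.
apply/existsP; have /andP[_] := aU; apply: contraNT; rewrite negb_exists => /forallP h.
rewrite -mE; apply: golodI ij bI cI _; rewrite mE.
apply: lepm_trans (lem_subr _ _) _; apply/mnm_lepP => x; rewrite aE mnmDE.
(* [far] compares with max(l_x, 1); when l_x = 0, these two bounds force exponent 0. *)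
have bx : (b x <= l x)%N by apply/mnm_lepP.
have cx : (c x <= l x)%N by apply/mnm_lepP.
have [xI|/vi_codom[y yE]] := boolP ('X_x \in I).
  by rewrite (std_out (cc_std nzb)) // (std_out (cc_std nzc)).
have := h y; rewrite yE aE mnmDE -leqNgt; move: bx cx.
by move: (b x) (c x) (l x); clear; lia.
Qed.

End Multigraded.

(** * Bases of subquotients *)

Section FiniteDimension.
Variable k : fieldType.

(** While some vector satisfying P lies outside V, adjoining it raises the dimension, which is
    bounded. *)
Lemma vspace_of_pred (U : vectType k) (P : U -> Prop) :
  P 0 -> (forall a u v, P u -> P v -> P (a *: u + v)) ->
  exists V : {vspace U}, forall u, u \in V <-> P u.
Proof.
move=> P0 PD.
suff ext d (V : {vspace U}) : (\dim {:U} - \dim V < d)%N -> (forall u, u \in V -> P u) ->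
    exists W : {vspace U}, forall u, u \in W <-> P u.
  apply: (ext _ 0%VS (ltnSn _)) => u; rewrite memv0 => /eqP->; exact: P0.
elim: d V => // d IH V dV VP.
have [h|h] := classic (forall u, P u -> u \in V); first by exists V => u; split; auto.
have [u hu] := not_all_ex_not _ _ h.
have [Pu /negP uV] := imply_to_and _ _ hu.
apply: (IH (V + <[u]>)%VS) => [|w /memv_addP[v vV [_ /vlineP[a ->] ->]]]; last first.
  by rewrite addrC; apply: PD => //; apply: VP.
have lt : (\dim V < \dim (V + <[u]>))%N.
  rewrite (ltn_leqif (dimv_leqif_sup (addvSl _ _))).
  apply: contra uV => /subvP; apply.
  by have := memv_add (mem0v V) (memv_line u); rewrite add0r.
apply: leq_trans (ltn_sub2l _ lt) dV.
exact: leq_trans lt (dimvS (subvf _)).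
Qed.

Variables (R : comNzRingType) (iota : {rmorphism k -> R}) (M : lmodType R).
Implicit Types Z B : M -> Prop.

(** Z and B are pulled back to subspaces of k^J along g, whose span contains Z. A complement of
    their intersection in the first has a basis mapping to one of Z modulo B. *)
Lemma has_dim_quotient Z B (J : finType) (g : J -> M) :
  Z 0 -> (forall a u v, Z u -> Z v -> Z (iota a *: u + v)) ->
  B 0 -> (forall a u v, B u -> B v -> B (iota a *: u + v)) ->
  (forall z, Z z -> exists c : J -> k, z = \sum_j iota (c j) *: g j) ->
  exists d, has_dim iota Z B d.
Proof.
move=> Z0 ZD B0 BD Zg.
pose lin (c : 'rV[k]_#|J|) := \sum_j iota (c 0 (enum_rank j)) *: g j.
have linP a c c' : lin (a *: c + c') = iota a *: lin c + lin c'.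
  rewrite /lin scaler_sumr -big_split; apply: eq_bigr => j _.
  by rewrite !mxE rmorphD rmorphM scalerDl scalerA.
have lin0 : lin 0 = 0 by rewrite /lin big1 // => j _; rewrite mxE rmorph0 scale0r.
have [|a u v zu zv|VZ VZP] := @vspace_of_pred _ (fun c => Z (lin c)); first by rewrite lin0.
  by rewrite linP; apply: ZD.
have [|a u v zu zv|VB VBP] := @vspace_of_pred _ (fun c => B (lin c)); first by rewrite lin0.
  by rewrite linP; apply: BD.
pose W := (VZ :\: VB)%VS; pose X := vbasis W.
have linS d (a : 'I_d -> k) (u : 'I_d -> 'rV_#|J|) :
    \sum_i iota (a i) *: lin (u i) = lin (\sum_i a i *: u i).
  elim/big_rec2: _ => [|i y1 y2 _ ->]; first by rewrite lin0.
  by rewrite linP.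
exists (\dim W), (fun i => lin X`_i); split.
- move=> i; apply/VZP; apply: (subvP (diffvSl VZ VB)).
  by apply: vbasis_mem; rewrite mem_nth // size_tuple.
- move=> a; rewrite linS => /VBP aB.
  have aW : \sum_i a i *: X`_i \in W.
    by apply: memv_suml => i _; apply: memvZ; apply: vbasis_mem; rewrite mem_nth ?size_tuple.
  have : \sum_i a i *: X`_i \in (W :&: VB)%VS by rewrite memv_cap aW.
  rewrite capv_diff memv0 => /eqP a0.
  by move/freeP: (basis_free (vbasisP W)); apply.
move=> z Zz; have [c zE] := Zg z Zz.
pose v : 'rV[k]_#|J| := \row_i c (enum_val i).
have vE : lin v = z by rewrite zE; apply: eq_bigr => j _; rewrite mxE enum_rankK.
have : v \in (W + VZ :&: VB)%VS by rewrite addv_diff_cap; apply/VZP; rewrite vE.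
case/memv_addP=> w wW [b]; rewrite memv_cap => /andP[_ /VBP bB] vwb.
exists (fun i => coord X i w); rewrite linS -(coord_vbasis wW) -vE vwb.
by have := linP 1 w b; rewrite scale1r rmorph1 scale1r => ->; rewrite addrC addKr.
Qed.

End FiniteDimension.

(** * Assembling the resolution *)

(** The last term is P N and the one before it is 0, as the denominator has no linear term; the
    others cancel the sum in the recursion. *)
Lemma golod_sum (c P h : nat -> nat) :
  (forall N, P N = c N + \sum_(0 <= j < N.-1) h j.+1 * P (N - j.+2))%N ->
  forall N, \sum_(i < N.+1) (P i)%:Z * golod_denom h (N - i) = (c N)%:Z.
Proof.
move=> PE N; rewrite big_ord_recr /= subnn mulr1 [in (P N)%:Z]PE.
rewrite (reindex_inj rev_ord_inj) /=.
rewrite (eq_bigr (fun i : 'I_N => (P (N - i.+1)%N)%:Z * golod_denom h i.+1)) => [|i _]; last first.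
  by rewrite subKn.
case: N => [|N]; first by rewrite big_ord0 big_geq // addn0 add0r.
rewrite big_ord_recl mulr0 add0r big_mkord PoszD addrCA -[RHS]addr0; congr (_ + _).
rewrite (big_morph Posz PoszD (erefl _)) -big_split big1 //= => i _.
by rewrite /bump /= add1n mulrN PoszM mulrC addNr.
Qed.

Section Assembly.
Variables (k : fieldType) (n : nat) (I : idealr {mpoly k[n]}) (G : seq 'X_{1..n}).
Hypothesis k0 : [pchar k] =i pred0.
Hypothesis IG : generates G I.
Local Notation R := {ideal_quot I}.
Local Notation l := (lcm_monomials G).
Hypothesis golodI : forall (i j : 'I_n) (m m' : 'X_{1..n}), i != j ->
  'X_[m + U_(i)] \in I -> 'X_[m' + U_(j)] \in I -> (m + m' <= l)%MM ->
  'X_[m + m'] \in I.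
Implicit Types (m a : 'X_{1..n}) (r : R).

(** Variables in I vanish in R; the remaining ones generate its maximal ideal minimally. *)
Definition outvars : {set 'I_n} := [set c | 'X_c \notin I].
Local Notation e := #|outvars|.
Definition vi (j : 'I_e) : 'I_n := enum_val j.
Definition xv (j : 'I_e) : R := proj I 'X_(vi j).
Local Notation ext := {ffun {set 'I_e} -> R^o}.
Local Notation delta := (edelta xv).

Lemma vi_inj : injective vi. Proof. exact: enum_val_inj. Qed.

Lemma vi_notin j : 'X_(vi j) \notin I.
Proof. by have := enum_valP j; rewrite inE. Qed.

Lemma vi_codom c : 'X_c \notin I -> exists j, vi j = c.
Proof.
move=> cI; have cP : c \in outvars by rewrite inE.
by exists (enum_rank_in cP c); rewrite /vi enum_rankK_in.
Qed.

(** Shape of [M_span] for all n variables, through which [M_sum], [M_mul] and [M_gen] apply to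
    [max_ideal]. *)
Lemma max_ideal_gens r :
  max_ideal r <-> exists c : 'I_n -> R, r = \sum_i c i * proj I 'X_i.
Proof. by []. Qed.

Lemma max_idealP r : reflect (max_ideal r) (rcoef r 0 == 0).
Proof.
apply: (iffP eqP) => [r0|[c ->]]; last first.
  by rewrite (rcoef_sum k0 IG) big1 // => i _; rewrite (rcoefM_X k0 IG) mnm0E eqxx orbT.
rewrite -(proj_repr r) [repr r]mpolyE /proj rmorph_sum /=.
rewrite big_seq; apply: (M_sum max_ideal_gens) => m; rewrite mcoeff_msupp => rm.
have m0 : m != 0%MM.
  apply: contraNneq rm => m0; move: r0; rewrite /rcoef -m0; case: ifP => // mI.
    by rewrite m0 (negPf (X0_notin I)) in mI.
  by move=> ->.
have [c mc] : exists c, m c != 0%N.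
  apply/existsP; apply: contraNT m0; rewrite negb_exists => /forallP h.
  by apply/eqP/mnmP => c; rewrite mnm0E; apply/eqP; rewrite -[_ == _]negbK h.
have Um : (U_(c) <= m)%MM by rewrite lep1mP.
rewrite -(submK Um) mpolyXD -mul_mpolyC mulrA rmorphM.
exact: (M_mul max_ideal_gens) (M_gen max_ideal_gens c).
Qed.

Lemma rcoef_scalar1 c m : rcoef (scalar I c) m = if m == 0%MM then c else 0.
Proof.
rewrite (rcoef_proj k0 IG); case: eqP => [->|/eqP m0]; rewrite mcoeffC ?eqxx ?(negPf m0) ?mulr0 ?if_same //.
by rewrite (negPf (X0_notin I)) mulr1.
Qed.

Lemma max_ideal_scalar c : max_ideal (scalar I c) -> c = 0.
Proof. by move=> /max_idealP; rewrite rcoef_scalar1 eqxx => /eqP. Qed.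

Lemma max_ideal_residue r : exists c, max_ideal (r - scalar_rmorph I c).
Proof.
exists (rcoef r 0); apply/max_idealP.
by rewrite (rcoefD k0 IG) (rcoefN k0 IG) rcoef_scalar1 eqxx subrr.
Qed.

Lemma max_ideal_span r : max_ideal r <-> exists c : 'I_e -> R, r = \sum_j c j * xv j.
Proof.
split=> [[c ->]|[c ->]]; last first.
  apply: (M_sum max_ideal_gens) => j _.
  exact: (M_mul max_ideal_gens) (M_gen max_ideal_gens (vi j)).
exists (fun j => c (vi j)).
rewrite (bigID (fun i => i \in outvars)) /= [X in _ + X]big1 ?addr0 => [|i].
  by rewrite big_enum_val.
rewrite inE negbK => iI; have /eqP-> : proj I 'X_i == 0 by rewrite -proj0 proj_eq // subr0.
by rewrite mulr0.
Qed.

Lemma rcoef_xv r i j : rcoef (r * xv i) U_(vi j) = if i == j then rcoef r 0 else 0.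
Proof.
rewrite (rcoefM_X k0 IG) (negPf (vi_notin j)) /= mnm1E (inj_eq vi_inj) (eq_sym j).
by case: (i =P j) => //= ->; congr rcoef; apply/mnmP => c; rewrite mnmBE mnm0E subnn.
Qed.

Lemma max_ideal_sq_coef r j : max_ideal_sq r -> rcoef r U_(vi j) = 0.
Proof.
case=> s sM ->; rewrite (rcoef_sum k0 IG) big_seq big1 // => p /sM[/max_idealP/eqP p1 /max_idealP/eqP p2].
apply/eqP/negPn/negP => /(rcoefM_supp k0 IG)[m1 [m2 [mE nz1 nz2]]].
have := congr1 (@mdeg n) mE; rewrite mdeg1 mdegD => E.
have [m10|m10] := eqVneq (mdeg m1) 0%N.
  by move: nz1; move/eqP: m10; rewrite mdeg_eq0 => /eqP->; rewrite p1 eqxx.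
have /eqP : mdeg m2 = 0%N by lia.
by rewrite mdeg_eq0 => /eqP m20; rewrite m20 p2 eqxx in nz2.
Qed.

Lemma edim_outvars : is_edim I e.
Proof.
exists xv; split=> [j|a sq j|z /max_ideal_span[c ->]].
- exact: (M_gen max_ideal_gens (vi j)).
- have := max_ideal_sq_coef j sq; rewrite (rcoef_sum k0 IG) (bigD1 j) //= big1 => [|i ij].
    by rewrite addr0 rcoef_xv eqxx rcoef_scalar1 eqxx.
  by rewrite rcoef_xv (negPf ij).
exists (fun j => rcoef (c j) 0).
exists [seq (c j - scalar I (rcoef (c j) 0), xv j) | j <- enum 'I_e].
  move=> p /mapP[j _ ->] /=; split; last exact: (M_gen max_ideal_gens (vi j)).
  by apply/max_idealP; rewrite (rcoefD k0 IG) (rcoefN k0 IG) rcoef_scalar1 eqxx subrr.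
rewrite big_map big_enum /= -sumrB; apply: eq_bigr => j _.
by rewrite mulrBl.
Qed.

Lemma minimal_xv : minimal_generators xv.
Proof.
split=> [i|r|j [c E]].
- by exists 1%N, 'X_(vi i) => //; rewrite dhomogX /= mdeg1 eqxx.
- exact: (max_ideal_span r).
have := congr1 (fun r => rcoef r U_(vi j)) E; rewrite /= (rcoef_sum k0 IG).
rewrite -[X in rcoef X]mul1r rcoef_xv eqxx -(rmorph1 (scalar_rmorph I)) rcoef_scalar1 eqxx.
rewrite big1 => [/eqP|i ij]; first by rewrite oner_eq0.
by rewrite rcoef_xv (negPf ij).
Qed.

(** * Finite-dimensional homology from near cycles *)

Local Notation near := (near (I := I) G vi).
Local Notation far := (far (I := I) G vi).
Local Notation homotopy := (homotopy (I := I) G vi).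
Local Notation bound j := (koszul_bound xv j).
Local Notation cycle j := (koszul_cycle xv j).

Lemma near0 : near 0.
Proof. by move=> a S; rewrite (cc0 k0 IG) eqxx. Qed.

Lemma near_lin c w w' : near w -> near w' -> near (scalar I c *: w + w').
Proof.
move=> nw nw' a S; rewrite (ccD k0 IG) (ccZ k0 IG).
have [->|wa _] := eqVneq (cc vi w a S) 0; last exact: nw.
by rewrite mulr0 add0r; apply: nw'.
Qed.

(** Only finitely many multidegrees divide l, so near elements lie in one finite-dimensional
    space. *)
Lemma near_expand w : near w ->
  exists c : {set 'I_e} * 'X_{1..n < (mdeg l).+1} -> k,
  w = \sum_p scalar I (c p) *: (proj I 'X_[p.2] *: ebas R p.1).
Proof.
move=> nw.
exists (fun p : {set 'I_e} * 'X_{1..n < (mdeg l).+1} => rcoef (w p.1) p.2).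
rewrite -(pair_big predT predT (fun S (m : 'X_{1..n < (mdeg l).+1}) =>
  scalar I (rcoef (w S) m) *: (proj I 'X_[m] *: ebas R S))) /=.
rewrite {1}(ext_expand w); apply: eq_bigr => S _.
under eq_bigr do rewrite scalerA; rewrite -scaler_suml; congr (_ *: _).
have -> : \sum_(m : 'X_{1..n < (mdeg l).+1}) scalar I (rcoef (w S) m) * proj I 'X_[m] =
    of_coefs I (mdeg l).+1 (rcoef (w S)).
  rewrite /of_coefs /proj rmorph_sum; apply: eq_bigr => m _.
  by rewrite /scalar -rmorphM mul_mpolyC.
apply: (rcoef_inj k0 IG) => m; rewrite (rcoef_of_coefs k0 IG).
case: (boolP (_ \in I)) => [/rcoef_in->//|mI /=]; case: leqP => // lm.
apply/eqP; apply: contraTT lm; rewrite (rcoef_cc vi) => /nw[ml _]; rewrite -leqNgt.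
by rewrite -(submK ml) !mdegD addnA addnAC leq_addl.
Qed.

Definition near_cycle j (w : ext) := [/\ edeg j w, delta w = 0 & near w].

Lemma near_cycle_dim j : exists d, has_dim (scalar I) (near_cycle j) (bound j) d.
Proof.
apply: (@has_dim_quotient k R (scalar_rmorph I) _ (near_cycle j) (bound j) _
  (fun p : {set 'I_e} * 'X_{1..n < (mdeg l).+1} => proj I 'X_[p.2] *: ebas R p.1)).
- by split; [apply: edeg0 | rewrite edelta0 | apply: near0].
- move=> c w w' [w1 w2 w3] [w1' w2' w3']; split; last exact: near_lin.
    by apply: edegD => //; apply: edegZ.
  by rewrite edeltaD edeltaZ w2 w2' scaler0 addr0.
- by exists 0; [apply: edeg0 | rewrite [RHS](edelta0 xv)].
- move=> c _ _ [u du ->] [u' du' ->]; exists (scalar I c *: u + u').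
    by apply: edegD => //; apply: edegZ.
  by rewrite [RHS](edeltaD xv) [X in _ = X + _](edeltaZ xv).
- by move=> w [_ _ /near_expand].
Qed.

Lemma cycle_near j (w : ext) : cycle j.+1 w -> exists2 w', near_cycle j.+1 w' & bound j.+1 (w - w').
Proof.
case=> w1' w2'; have w1 : edeg j.+1 w := w1'; have w2 : delta w = 0 := w2'.
exists (near_part G vi w).
  split; [exact: (near_part_deg k0 IG) | | exact: (near_part_is_near k0 IG vi_inj vi_codom vi_notin w1)].
  by rewrite /near_part w2 (homotopy0 k0 IG) subr0 edeltaD edeltaN edeltaK w2 subr0.
exists (homotopy w); first exact: (homotopy_deg k0 IG).
by rewrite /near_part w2 (homotopy0 k0 IG) subr0 opprB addrC subrK.
Qed.

(** * The resolution attached to bases of near cycles *)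

Variables (d : 'I_e -> nat) (u : forall i, 'I_(d i) -> ext).
Hypothesis u_cycle : forall (i : 'I_e) (t : 'I_(d i)), near_cycle i.+1 (@u i t).
Hypothesis u_free : forall i (c : 'I_(d i) -> k),
  bound i.+1 (\sum_t scalar I (c t) *: u t) -> forall t, c t = 0.
Hypothesis u_span : forall (i : 'I_e) (z : ext), near_cycle i.+1 z ->
  exists c : 'I_(d i) -> k, bound i.+1 (z - \sum_t scalar I (c t) *: u t).

Local Notation B := {i : 'I_e & 'I_(d i)}.
(** The index of a letter starts at 0 and stands for homology in degree one higher. *)
Definition hdeg (b : B) : nat := (tag b).+1.
Definition hcyc (b : B) : ext := u (tagged b).

Definition hbas (i : 'I_e) (t : 'I_(d i)) : B := Tagged (fun i => 'I_(d i)) t.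

Lemma big_hbas (V : nmodType) (P : pred 'I_e) (F : B -> V) :
  \sum_(b | P (tag b)) F b = \sum_(i | P i) \sum_t F (@hbas i t).
Proof.
rewrite (sig_big_dep P (fun i => predT) (fun i t => F (@hbas i t))).
by apply: eq_big => [b|[i t] _] //; rewrite andbT.
Qed.

Lemma big_hdeg (V : nmodType) (i : 'I_e) (F : B -> V) :
  \sum_(b | hdeg b == i.+1) F b = \sum_t F (@hbas i t).
Proof.
transitivity (\sum_(i' | i' == i) \sum_t F (@hbas i' t)); last by rewrite big_pred1_eq.
rewrite -(big_hbas (fun i' => i' == i)).
by apply: eq_bigl => b; rewrite /hdeg eqSS.
Qed.

Lemma hcyc_near b : near_cycle (hdeg b) (hcyc b).
Proof. exact: u_cycle. Qed.

Lemma hcyc_free j (c : B -> k) (y : ext) : (0 < j)%N -> edeg j.+1 y ->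
  \sum_(b | hdeg b == j) scalar_rmorph I (c b) *: hcyc b = delta y ->
  forall b, hdeg b = j -> c b = 0.
Proof.
move=> _ dy E b bj; rewrite -bj /hdeg in dy E; case: b bj dy E => i t /= _ dy E.
apply: (@u_free i (fun t => c (hbas t))).
by exists y => //; rewrite -[RHS]E -/hdeg big_hdeg.
Qed.

Lemma hcyc_span j (z : ext) : (0 < j)%N -> edeg j z -> delta z = 0 ->
  exists (c : B -> k) (y : ext), edeg j.+1 y /\
    z = \sum_(b | hdeg b == j) scalar_rmorph I (c b) *: hcyc b + delta y.
Proof.
case: j => // j _ dz z0; have [je|ej] := ltnP j e; last first.
  exists (fun=> 0), 0; split; first exact: edeg0.
  rewrite big1 ?edelta0 ?addr0 => [|b _]; last by rewrite rmorph0 scale0r.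
  apply/ffunP => S; rewrite dz ?ffunE //; apply: contraTneq ej => Sj.
  by rewrite -ltnNge -Sj -[X in (_ <= X)%N]card_ord max_card.
pose i := Ordinal je; have [w wn [y dy E]] : exists2 w, near_cycle i.+1 w & bound i.+1 (z - w).
  by apply: cycle_near; split.
(* The coefficients found in degree i are extended to every index, to obtain one function on all
   letters. *)
have /(@fin_all_exists _ (fun i => 'I_(d i) -> k))[C CP] i' : exists c : 'I_(d i') -> k,
    i' = i -> bound i.+1 (w - \sum_t scalar I (c t) *: u t).
  have [->|ni] := eqVneq i' i; first by have [c cP] := u_span wn; exists c.
  by exists (fun=> 0) => /eqP; rewrite (negPf ni).
have [y' dy' E'] := CP i erefl.
exists (fun b => C (tag b) (tagged b)), (y + y'); split; first exact: edegD.
have -> : delta (y + y') = z - \sum_t scalar I (C i t) *: u t.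
  by rewrite edeltaD -[delta y]E -[delta y']E' addrA subrK.
by rewrite (@big_hdeg _ i) addrC subrK.
Qed.

Definition gam := massey hcyc homotopy.

Lemma far_homotopyP j w : edeg j w -> far w -> delta w = 0 ->
  [/\ far (homotopy w), edeg j.+1 (homotopy w) & delta (homotopy w) = w].
Proof.
move=> dw fw w0; split; [exact: (far_homotopy k0 IG) | exact: (homotopy_deg k0 IG) |].
exact: (far_contract k0 IG vi_inj).
Qed.

Lemma gamP v : v != [::] -> [/\ edeg (wt hdeg v).-1 (gam v),
  (1 < size v)%N -> far (gam v) & delta (gam v) = - massey_sum hcyc homotopy v].
Proof.
have hz b : [/\ edeg (hdeg b) (hcyc b), delta (hcyc b) = 0 & near (hcyc b)] by apply: hcyc_near.
apply: masseyP => [b|b||r w w'|w w'|w w'|b b'|].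
- by have [] := hz b.
- by have [] := hz b.
- exact: (far0 k0 IG).
- exact: (far_lin k0 IG).
- exact: (far_mull k0 IG).
- exact: (far_mulr k0 IG).
- have [_ _ b1] := hz b; have [_ _ b2] := hz b'.
  exact: (near_mul k0 IG vi_inj vi_codom golodI vi_notin).
exact: far_homotopyP.
Qed.

Lemma gam_deg v j : wt hdeg v = j.+1 -> edeg j (gam v).
Proof.
move=> vj; have [|h _ _] := @gamP v; first by case: v vj.
by move: h; rewrite vj.
Qed.

(** A constant coefficient sits in the squarefree multidegree [mon S]. For longer words [far]
    demands an exponent above 1; for one letter, [near] would put a variable from outside I into
    I. *)
Lemma gam_max v S : v != [::] -> max_ideal (gam v S).
Proof.
move=> v0; apply/max_idealP/negPn/negP; rewrite (rcoef_cc vi) add0m => nz.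
have [v1|v1] := leqP (size v) 1; last first.
  have [_ /(_ v1)/(_ _ _ nz)[j]] := gamP v0.
  by rewrite (monE vi_inj) gtn_max => /andP[_]; case: (j \in S).
have [b vb] : exists b, v = [:: b] by case: v v0 v1 {nz} => [|b []] // _ _; exists b.
rewrite vb in nz; have [_ _ /(_ _ _ nz)[_ [i [_ _]]]] := hcyc_near b.
rewrite (_ : (mon vi S - mon vi S + _ = U_(vi i))%MM) ?(negPf (vi_notin i)) //.
by apply/mnmP => c; rewrite mnmDE mnmBE subnn.
Qed.

Definition hrank j : nat := if insub j is Some i then d i else 0%N.

Definition hdim j : nat := if j is j'.+1 then hrank j' else 1%N.

Lemma hrank_ord (i : 'I_e) : hrank i = d i.
Proof. by rewrite /hrank valK. Qed.

Lemma hrank_big j : (e <= j)%N -> hrank j = 0%N.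
Proof. by move=> ej; rewrite /hrank insubF // ltnNge ej. Qed.

Lemma betti_hrank N : betti e hdeg N =
  ('C(e, N) + \sum_(0 <= j < N.-1) hrank j * betti e hdeg (N - j.+2))%N.
Proof.
rewrite betti_rec; congr addn.
rewrite (big_hbas (fun i => i.+1 < N)%N (fun b => betti e hdeg (N - (hdeg b).+1))).
rewrite (eq_bigr (fun i : 'I_e => hrank i * betti e hdeg (N - i.+2))%N) => [|i _]; last first.
  by rewrite hrank_ord /hdeg /= sum_nat_const card_ord.
rewrite -(big_mkord (fun i => i.+1 < N)%N (fun j => hrank j * betti e hdeg (N - j.+2))%N).
(* Both sums are extended to a common range; [hrank] is zero from e on. *)
rewrite (big_nat_widen _ _ (e + N)) ?leq_addr // [RHS](big_nat_widen _ _ (e + N)); last by lia.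
rewrite big_mkcond [RHS]big_mkcond; apply: eq_bigr => j _ /=.
have [ej|je] := leqP e j; first by rewrite hrank_big // mul0n andbF; case: ifP.
by rewrite andbT ltn_predRL.
Qed.

Lemma koszul_hdim : koszul_dims I hdim.
Proof.
exists e, xv; split; first exact: minimal_xv.
have e0 : edeg 0 (ebas R (set0 : {set 'I_e})).
  by have := @edeg_ebas R e set0; rewrite cards0.
have de0 := edelta_edeg0 xv e0.
case=> [|j].
  exists (fun=> ebas R set0); split=> [_|c|z [dz _]]; first by split.
    rewrite big_ord1 => -[y dy E] t; rewrite ord1; apply: max_ideal_scalar.
    have := congr1 (fun w : ext => w set0) E; rewrite !ffunE eqxx /GRing.scale /= mulr1 => ->.
    apply: (M_sum max_ideal_span) => i _; rewrite mulrAC.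
    exact: (M_mul max_ideal_span) (M_gen max_ideal_span i).
  exists (fun=> rcoef (z set0) 0); rewrite big_ord1.
  have -> : z - scalar I (rcoef (z set0) 0) *: ebas R set0 =
      (z set0 - scalar I (rcoef (z set0) 0)) *: ebas R set0.
    by rewrite scalerBl -(edeg0P dz).
  have [|y dy yE] := M_bound max_ideal_span (r := z set0 - scalar I (rcoef (z set0) 0)) _ e0 de0.
    by apply/max_idealP; rewrite (rcoefD k0 IG) (rcoefN k0 IG) rcoef_scalar1 eqxx subrr.
  by exists y.
have [ej|je] := leqP e j.
  rewrite /hdim hrank_big //; exists (fun=> 0); split=> [[]|c _ []|z [dz _]] //.
  exists (fun=> 0); exists 0; first exact: edeg0.
  rewrite big_ord0 subr0 [RHS](edelta0 xv); apply/ffunP => S; rewrite [LHS]dz ?ffunE //.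
  apply: contraTneq ej => Sj.
  by rewrite -ltnNge -Sj -[X in (_ <= X)%N]card_ord max_card.
pose i := Ordinal je; have -> : hdim j.+1 = d i by rewrite /hdim -hrank_ord.
exists (@u i); split=> [t|c|z zc].
- by have [t1 t2 _] := u_cycle t.
- exact: (@u_free i c).
have [w wn [y dy E]] := cycle_near zc; have [c [y' dy' E']] := @u_span i w wn.
exists c, (y + y'); first exact: edegD.
by rewrite [RHS](edeltaD xv) -[edelta xv y]E -[edelta xv y']E' addrA subrK.
Qed.

Lemma row_comb p (c : 'I_p -> R) t : (\sum_i c i *: delta_mx 0 i : 'rV[R]_p) 0 t = c t.
Proof.
rewrite summxE (bigD1 t) //= !mxE !eqxx mulr1 big1 ?addr0 // => i it.
by rewrite !mxE eqxx eq_sym (negPf it) mulr0.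
Qed.

(** The resolution is minimal: modulo the maximal ideal its differentials vanish, so every vector is
    a cycle, boundaries are zero, and the unit vectors form a basis of Tor. *)
Lemma tor_betti : tor_dims I (betti e hdeg).
Proof.
have gd v : v != [::] -> delta (gam v) =
    - \sum_(1 <= i < size v) emul (bar (gam (take i v))) (gam (drop i v)).
  by move=> v0; have [_ _ ->] := gamP v0.
have h0 b : (0 < hdeg b)%N by [].
exists (betti e hdeg), (dmx xv hdeg gam), (augm R e hdeg); split.
  have h1 := @augm_surj R e xv B hdeg _ max_ideal_span.
  have h2 := augm_exact gam_deg max_ideal_span gam_max.
  have h3 := dmx_exact gd gam_deg max_ideal_span max_ideal_residue h0 hcyc_free hcyc_span.
  by split; [exact: h1 | exact: h2 | exact: h3].
have dM := dmx_M max_ideal_span gam_max.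
have mulM j (v : 'rV[R]_(betti e hdeg j.+1)) : in_mF (v *m dmx xv hdeg gam j).
  move=> t; rewrite mxE; apply: (M_sum max_ideal_span) => t' _.
  by apply: (M_mul max_ideal_span); apply: dM.
move=> j; exists (fun t => delta_mx 0 t); split=> [t|c|v _].
- by case: j t => [|j] t //; apply: mulM.
- case=> w wM t; apply: max_ideal_scalar; have := M_add max_ideal_span (wM t) (mulM j w t).
  set A := \sum_i _; set C := w *m _.
  have -> : (A - C) 0 t + C 0 t = (A - C + C) 0 t by rewrite [RHS]mxE.
  by rewrite subrK row_comb.
exists (fun t => rcoef (v 0 t) 0), 0 => t; rewrite mul0mx subr0.
set A := \sum_i _; have -> : (v - A) 0 t = v 0 t - A 0 t by rewrite [LHS]mxE [(- A) 0 t]mxE.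
rewrite row_comb.
by apply/max_idealP; rewrite (rcoefD k0 IG) (rcoefN k0 IG) rcoef_scalar1 eqxx subrr.
Qed.

Lemma golod_outvars : golod I.
Proof.
exists e, (betti e hdeg), hdim; split.
- exact: edim_outvars.
- exact: tor_betti.
- exact: koszul_hdim.
move=> N; apply: golod_sum => N'; exact: betti_hrank.
Qed.

End Assembly.

(** The derivative of x^(m + U_i) in direction i is x^m times the integer m_i + 1, invertible in
    characteristic zero, so the condition on derivatives becomes one on monomials. *)
Lemma lcm_golod_shift (k : fieldType) (n : nat) (I : idealr {mpoly k[n]}) (G : seq 'X_{1..n}) :
  [pchar k] =i pred0 ->
  (forall (i j : 'I_n) (f g : 'X_{1..n}),
    i != j -> 'X_[f] \in I -> 'X_[g] \in I ->
    (exists q : {mpoly k[n]},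
        'X_[lcm_monomials G] = q * (('X_[f])^`M(i) * ('X_[g])^`M(j))) ->
    ('X_[f])^`M(i) * ('X_[g])^`M(j) \in I) ->
  forall (i j : 'I_n) (m m' : 'X_{1..n}), i != j ->
  'X_[m + U_(i)] \in I -> 'X_[m' + U_(j)] \in I -> (m + m' <= lcm_monomials G)%MM ->
  'X_[m + m'] \in I.
Proof.
move=> k0 h i j m m' ij mI m'I ml; have := h _ _ _ _ ij mI m'I.
rewrite !mderivX !addmK -scalerAl -scalerAr scalerA -mpolyXD.
set c := _ * _; have c0 : c != 0.
  by rewrite mulf_neq0 // ((pcharf0P k).1 k0) mnmDE mnm1E eqxx addn1.
move=> cI; have {}cI : c *: 'X_[m + m'] \in I.
  apply: cI; exists (c^-1 *: 'X_[lcm_monomials G - (m + m')]).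
  by rewrite -scalerAl -scalerAr scalerA mulVf // scale1r -mpolyXD submK.
by rewrite -['X_[m + m']]scale1r -(mulVf c0) -scalerA -mul_mpolyC idealMr.
Qed.

Theorem theorem3 (k : fieldType) (n : nat) (I : idealr {mpoly k[n]}) :
  [pchar k] =i pred0 ->
  monomial_ideal I ->
  lcm_strongly_golod I ->
  golod I.
Proof.
move=> k0 _ [G [IG _] /(lcm_golod_shift k0) golodI].
(* Dimensions and representatives are chosen at once in the degrees from 1 to the number of
   variables outside I. *)
have [d /(@fin_all_exists _ _ _)[u uP]] :=
  @fin_all_exists _ (fun=> nat) _ (fun i : 'I_#|outvars I| => near_cycle_dim k0 IG i.+1).
by apply: (golod_outvars k0 IG golodI (u := u)) => i; have [] := uP i.
Qed.
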